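(* Let $W:\mathcal{X}\to\mathcal{P}(\mathsf{Y})$ be a discrete channel and, for each $n$, let $W_{\vec{[1,n]}}$ be the length $n$ discrete stationary product channel with feedback all of whose components equal $W$. Let $0<\alpha_0<\alpha_1<1$. Then for any sequence of codes, the $n$-th being an $(M_n,L_n)$ channel code on $W_{\vec{[1,n]}}$ with average error probability $P_e^{(n)}$, satisfying $$C_{\alpha_1,W}\ge\frac1n\ln\frac{M_n}{L_n}\ge C_{\alpha_0,W}+\frac{\ln n}{n^{1/4}}\quad\forall n\ge n_0$$ for some $n_0$, there exists $n_1\ge n_0$ such that $$P_e^{(n)}\ge \exp\Big(-n\Big[E_{sp}\big(\tfrac1n\ln\tfrac{M_n}{L_n},W\big)+\tfrac{1}{\alpha_0}\tfrac{\ln n}{n^{1/4}}\Big]\Big)\quad\forall n\ge n_1.$$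
   Context: A discrete channel $W$ is a map from a finite input set $\mathcal{X}$ to probability distributions on a finite output set $\mathsf{Y}$. The length $n$ discrete product channel with feedback built from discrete channels $W_t:\mathcal{X}_t\to\mathcal{P}(\mathsf{Y}_t)$ has input set $\mathcal{X}_1\times\prod_{t=2}^n\mathcal{X}_t^{\mathsf{Y}_1\times\cdots\times\mathsf{Y}_{t-1}}$ (an input is $(x_1,e_2,\dots,e_n)$ with $e_t$ a function of the past outputs), output set $\mathsf{Y}_1\times\cdots\times\mathsf{Y}_n$, and transition probabilities $W(y|x)=W_1(y_1|x_1)\prod_{t=2}^nW_t(y_t|e_t(y_1,\dots,y_{t-1}))$; it is stationary if all $W_t$ are equal. An $(M,L)$ channel code consists of an encoder $f:\{1,\dots,M\}\to$ input set and a decoder $\psi$ from the output set to the $L$-element subsets of $\{1,\dots,M\}$; average error probability $P_e=\frac1M\sum_m W(f(m))(\{y:m\notin\psi(y)\})$. Rényi divergence for distributions: $D_\alpha(w\|q)=\frac{1}{\alpha-1}\ln\sum_y w(y)^\alpha q(y)^{1-\alpha}$ ($\alpha\ne1$), $D_1(w\|q)=\sum_yw(y)\ln\frac{w(y)}{q(y)}$. Rényi information $I_\alpha(p;W)=\frac{\alpha}{\alpha-1}\ln\sum_y(\sum_xp(x)W(y|x)^\alpha)^{1/\alpha}$ ($\alpha\neq1$), $I_1$ the mutual information; Rényi capacity $C_{\alpha,W}=\sup_pI_\alpha(p;W)$. Sphere packing exponent $E_{sp}(R,W)=\sup_{\alpha\in(0,\infty)}\frac{1-\alpha}{\alpha}(C_{\alpha,W}-R)$.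 *)

(* Defs.v *)
From HB Require Import structures.
From mathcomp Require Import all_boot all_order all_algebra.
From mathcomp Require Import all_classical all_reals all_analysis.
Set Implicit Arguments. Unset Strict Implicit. Unset Printing Implicit Defensive.
Import Order.TTheory GRing.Theory Num.Theory.
Local Open Scope ring_scope.
Local Open Scope classical_set_scope.

Section Channels.
Variables (R : realType) (X Y : finType).

Definition is_channel (W : X -> Y -> R) : Prop :=
  (forall x y, 0 <= W x y) /\ (forall x, \sum_(y : Y) W x y = 1).

Definition is_dist (p : X -> R) : Prop :=
  (forall x, 0 <= p x) /\ \sum_(x : X) p x = 1.

Definition renyi_info (a : R) (p : X -> R) (W : X -> Y -> R) : R :=
  if a == 1 then
    \sum_(x : X) \sum_(y : Y)
       p x * W x y * ln (W x y / \sum_(x' : X) p x' * W x' y)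
  else a / (a - 1) *
       ln (\sum_(y : Y) (\sum_(x : X) p x * (W x y `^ a)) `^ a^-1).

Definition renyi_cap (a : R) (W : X -> Y -> R) : R :=
  sup [set renyi_info a p W | p in [set p | is_dist p]].

(* sphere packing exponent E_sp(r,W) = sup_{a in (0,oo)} (1-a)/a (C_{a,W} - r),
   as an extended real (it may be +oo) *)
Definition sp_exp (r : R) (W : X -> Y -> R) : \bar R :=
  ereal_sup [set (((1 - a) / a) * (renyi_cap a W - r))%:E | a in [set a : R | 0 < a]].

(* inputs of the length-n product channel with feedback:
   e t is a function of the past outputs y_1..y_t (0-indexed: of y_0..y_{t-1});
   e 0 is a function of the empty past, i.e. the input x_1 *)
Definition fb_input (n : nat) := forall t : 'I_n, {ffun 'I_t -> Y} -> X.

Definition past (n : nat) (y : {ffun 'I_n -> Y}) (t : 'I_n) : {ffun 'I_t -> Y} :=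
  [ffun i : 'I_t => y (widen_ord (ltnW (ltn_ord t)) i)].

Definition fb_chan (W : X -> Y -> R) (n : nat) (e : fb_input n)
    (y : {ffun 'I_n -> Y}) : R :=
  \prod_(t < n) W (e t (past y t)) (y t).

Record fb_code (n M L : nat) := Code {
  enc : 'I_M -> fb_input n ;
  dec : {ffun 'I_n -> Y} -> {set 'I_M} ;
  dec_card : forall y, #|dec y| = L ;
  L_gt0 : (0 < L)%N }.

Definition err_prob (W : X -> Y -> R) (n M L : nat) (c : fb_code n M L) : R :=
  (M%:R)^-1 * \sum_(m < M) \sum_(y : {ffun 'I_n -> Y} | m \notin dec c y)
                               fb_chan W (enc c m) y.

End Channels.

(* Main.v *)
Require Import Defs.
From HB Require Import structures.
From mathcomp Require Import all_boot all_order all_algebra.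
From mathcomp Require Import all_classical all_reals all_analysis.
From mathcomp Require Import ring lra zify.
Import Order.TTheory GRing.Theory Num.Theory.
Import numFieldNormedType.Exports.
Local Open Scope ring_scope.

(** Against a fixed output law [Q], a code of rate [r] is correct with
    [Q]-probability [exp (- n r)] on average.  Hence it suffices to exhibit, for
    every message, an output law [V] such that, with [V]-probability bounded
    below, [ln (V / Q) <= n r - s] and [ln (V / W) <= n E_sp(r) + s].

    With feedback the tilted law [V ~ W^b Q^(1-b)] of the whole code does not
    concentrate, so (Augustin) the horizon is cut into [k] blocks of length
    [k ~ sqrt n], the code being padded to length [k * k].  On a block, [Q] is a
    uniform mixture of the product laws built from the Renyi centers of orders
    in a grid of [k] points of [[a0, 1)]; it is within [ln k.+1] of being a Renyi
    center of the block channel for every order of the grid, at once.  So the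
    order [b] can be adapted to the block input (that is, to the past): by the
    intermediate value theorem it is chosen with [D(V || Q)] equal to the block
    rate, and then [D(V || W)] is at most the sphere packing exponent.  The
    centered log-likelihood ratios of the blocks are bounded martingale
    differences of size [O(k)], so Chebyshev's inequality makes the fluctuation
    [s = O(k^(3/2)) = O(n^(3/4))], which [n^(3/4) ln n] absorbs. *)

(** * Renyi centers *)

(** A power of a negative base takes the value 1, so the power function jumps at 0. Cutting the base
    off at 0 yields a function continuous on the whole line, as the compactness and limit arguments
    below require. *)
Lemma continuous_max0_powR {R : realType} (c : R) : 0 < c ->
  continuous (fun x : R => Num.max x 0 `^ c).
Proof.
move=> c0 a; have [a0|a0] := ltP 0 a.
  have H : {for a, continuous (fun x : R => expR (c * ln x))}.
    apply: continuous_comp; last exact: continuous_expR.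
    apply: continuousM; [exact: cst_continuous|exact: continuous_ln].
  apply: (@cvg_trans _ ((fun x : R => expR (c * ln x)) @ a)%classic).
    apply: near_eq_cvg; near=> b.
    have b0 : 0 < b by near: b; exact: lt_nbhsr.
    by rewrite max_l ?(ltW b0)// /powR gt_eqF.
  have -> : Num.max a 0 `^ c = expR (c * ln a).
    by rewrite max_l ?(ltW a0)// /powR gt_eqF.
  exact: H.
have E0 : Num.max a 0 `^ c = 0 by rewrite max_r// powR0 ?gt_eqF.
rewrite /continuous_at E0.
apply/cvgr0Pnorm_lt => e e0.
near=> x; rewrite ger0_norm ?powR_ge0//.
have xe : x < e `^ c^-1.
  near: x; apply: lt_nbhsl.
  by rewrite (le_lt_trans a0)// powR_gt0.
have -> : e = (e `^ c^-1) `^ c by rewrite -powRrM mulVf ?gt_eqF// powRr1// ltW.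
apply: gt0_ltr_powR => //; rewrite ?nnegrE ?powR_ge0//.
  by rewrite le_max lexx orbT.
by rewrite gt_max xe powR_gt0.
Unshelve. all: end_near. Qed.

(** Convexity of the power [c], obtained from Young's inequality with conjugate exponents [c] and
    [c / (c - 1)], without derivatives. *)
Lemma powR_tangent {R : realType} (c a b : R) : 1 < c -> 0 <= a -> 0 <= b ->
  b `^ c - a `^ c <= c * (b `^ (c - 1) * (b - a)).
Proof.
move=> c1 a0 b0; have c0 : 0 < c by apply: lt_trans c1.
have cm : 0 < c - 1 by rewrite subr_gt0.
have := @conjugate_powR R a (b `^ (c - 1)) c (c / (c - 1)) a0 (powR_ge0 _ _) c0.
rewrite divr_gt0// => /(_ isT).
have -> : c^-1 + (c / (c - 1))^-1 = 1 by field; rewrite !gt_eqF.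
move=> /(_ erefl).
have -> : (b `^ (c - 1)) `^ (c / (c - 1)) = b `^ c.
  by rewrite -powRrM; congr powR; field; rewrite gt_eqF.
have -> : (b `^ c) / (c / (c - 1)) = b `^ c * (1 - c^-1) by field; rewrite !gt_eqF.
rewrite -(ler_pM2l c0) => H.
have E : b * b `^ (c - 1) = b `^ c by rewrite mulr_powRB1.
have E2 : c * (a `^ c / c + b `^ c * (1 - c^-1)) = a `^ c + (c - 1) * b `^ c.
  by field; rewrite gt_eqF.
rewrite {}E2 in H; rewrite mulrBr [_ * b]mulrC E; lra.
Qed.

Section center.
Local Open Scope classical_set_scope.
Context {R : realType} {X Y : finType}.
Variables (W : X -> Y -> R) (a : R).
Hypotheses (Wch : is_channel W) (a0 : 0 < a) (a1 : a < 1).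

Definition renyi_mix (p : X -> R) (y : Y) : R := \sum_(x : X) p x * W x y `^ a.

(** Renyi information is [a / (a - 1)] times its logarithm. That factor is negative for [a < 1], so
    maximizing information means minimizing this function, which is convex because [1 < a^-1]. *)
Definition renyi_gain (p : X -> R) : R := \sum_(y : Y) renyi_mix p y `^ a^-1.

Lemma channel_le1 x y : W x y <= 1.
Proof.
by case: Wch => W0 W1; rewrite -(W1 x) (bigD1 y)//= lerDl sumr_ge0.
Qed.

Lemma renyi_mix_ge0 p y : (forall x, 0 <= p x) -> 0 <= renyi_mix p y.
Proof. by move=> p0; apply: sumr_ge0 => x _; rewrite mulr_ge0 ?powR_ge0. Qed.

Lemma sum_renyi_mix_ge1 p : is_dist p -> 1 <= \sum_y renyi_mix p y.
Proof.
move=> [p0 p1]; rewrite exchange_big/= -{1}p1; apply: ler_sum => x _.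
rewrite -mulr_sumr ler_peMr// -(Wch.2 x); apply: ler_sum => y _.
have [->|Wn0] := eqVneq (W x y) 0; first exact: powR_ge0.
have W0 : 0 < W x y by rewrite lt_neqAle eq_sym Wn0 Wch.1.
by apply: ger1_powR; rewrite ?W0 ?channel_le1// ltW.
Qed.

(** Pigeonhole: the values of [renyi_mix p] sum to at least 1, so one of them is at least the
    average. This bounds the information from above, which makes the real-valued [sup] of the
    capacity a true supremum. *)
Lemma renyi_gain_lb p : is_dist p -> (#|Y|%:R^-1) `^ a^-1 <= renyi_gain p.
Proof.
move=> pd; have s0 := renyi_mix_ge0 _ _ pd.1.
have [y hy] : exists y, #|Y|%:R^-1 <= renyi_mix p y.
  apply: contrapT => /forallNP H.
  have : \sum_y renyi_mix p y <= \sum_(y : Y) #|Y|%:R^-1.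
    by apply: ler_sum => y _; rewrite leNgt; apply/negP => /ltW; exact: H.
  have [Y0|Y0] := posnP #|Y|.
    have := sum_renyi_mix_ge1 _ pd.
    by rewrite big_pred0 ?ler10// => y; have := fintype0 y Y0.
  have [y0 _] : exists y : Y, y \in Y by apply/card_gt0P.
  have Hy : \sum_y renyi_mix p y < \sum_(y : Y) #|Y|%:R^-1.
    rewrite (bigD1 y0)//= [ltRHS](bigD1 y0)//=; apply: ltr_leD.
      by rewrite ltNge; apply/negP; exact: H.
    by apply: ler_sum => y _; rewrite leNgt; apply/negP => /ltW; exact: H.
  have := le_lt_trans (sum_renyi_mix_ge1 _ pd) Hy.
  rewrite sumr_const -[_ *+ _]mulr_natl divff ?ltxx//.
  by rewrite pnatr_eq0 -lt0n.
rewrite /renyi_gain (bigD1 y)//= ler_wpDr//.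
  by apply: sumr_ge0 => i _; exact: powR_ge0.
by apply: ge0_ler_powR; rewrite ?nnegrE ?invr_ge0 ?ler0n ?(ltW a0)//.
Qed.

Lemma renyi_gain_gt0 p : is_dist p -> 0 < renyi_gain p.
Proof.
move=> pd; apply: lt_le_trans (renyi_gain_lb _ pd).
have := sum_renyi_mix_ge1 _ pd.
have [Y0|Y0] := posnP #|Y|.
  by rewrite big_pred0 ?ler10// => y; have := fintype0 y Y0.
by move=> _; rewrite powR_gt0// invr_gt0 ltr0n.
Qed.

Lemma renyi_infoE p : renyi_info a p W = a / (a - 1) * ln (renyi_gain p).
Proof. by rewrite /renyi_info lt_eqF. Qed.

Lemma renyi_info_ub p : is_dist p -> renyi_info a p W <= ln #|Y|%:R / (1 - a).
Proof.
move=> pd; rewrite renyi_infoE.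
have : - (ln #|Y|%:R / a) <= ln (renyi_gain p) :> R.
  have [Y0|Y0] := posnP #|Y|.
    have := sum_renyi_mix_ge1 _ pd.
    by rewrite big_pred0 ?ler10// => y; have := fintype0 y Y0.
  have -> : - (ln #|Y|%:R / a) = ln (#|Y|%:R^-1 `^ a^-1) :> R.
    by rewrite ln_powR lnV ?posrE ?ltr0n// mulrN mulrC.
  by rewrite ler_ln ?posrE ?renyi_gain_gt0 ?renyi_gain_lb// powR_gt0// invr_gt0 ltr0n.
have b0 : 0 < 1 - a by rewrite subr_gt0.
have -> : a / (a - 1) * ln (renyi_gain p) = - (a * ln (renyi_gain p)) / (1 - a).
  by field; rewrite !subr_eq0 [1 == _]eq_sym (lt_eqF a1).
rewrite ler_pM2r ?invr_gt0// => H.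
have E : a * (ln #|Y|%:R / a) = ln #|Y|%:R :> R by rewrite mulrC divfK// gt_eqF.
by rewrite -(ler_pM2l a0) mulrN E in H; rewrite lerNl.
Qed.

Lemma renyi_info_le_cap p : is_dist p -> renyi_info a p W <= renyi_cap a W.
Proof.
move=> pd; apply: ub_le_sup; last by exists p.
by exists (ln #|Y|%:R / (1 - a)) => _ [p' pd' <-]; exact: renyi_info_ub.
Qed.

Lemma renyi_cap_ub (x0 : X) : renyi_cap a W <= ln #|Y|%:R / (1 - a).
Proof.
apply: ge_sup => [|_ [p' pd' <-]]; last exact: renyi_info_ub.
exists (renyi_info a (fun x => (x == x0)%:R) W); exists (fun x => (x == x0)%:R) => //.
split=> [x|]; first exact: ler0n.
by rewrite (bigD1 x0)//= eqxx big1 ?addr0// => x /negPf ->.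
Qed.

Lemma renyi_cap_ge0 : 0 <= renyi_cap a W.
Proof.
(* Without inputs there is no distribution, and [sup] of the empty set is 0; otherwise a point mass
   already has information 0. *)
have [x0|X0] := pselect (exists x : X, True); last first.
  rewrite /renyi_cap (_ : [set p | is_dist p]%classic = set0) ?image_set0 ?sup0//.
  apply/seteqP; split=> // p [_ p1]; exfalso.
  move: p1; rewrite big1 => [/eqP|x]; first by rewrite eq_sym oner_eq0.
  by case: X0; exists x.
case: x0 => x0 _.
have pd : is_dist (fun x => (x == x0)%:R : R).
  split=> [x|]; first exact: ler0n.
  by rewrite (bigD1 x0)//= eqxx big1 ?addr0// => x /negPf ->.
apply: le_trans (renyi_info_le_cap _ pd).
rewrite renyi_infoE (_ : renyi_gain _ = 1) ?ln1 ?mulr0//.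
apply: etrans (Wch.2 x0); apply: eq_bigr => y _; rewrite /renyi_mix (bigD1 x0)//= eqxx mulr1n mul1r.
rewrite big1 ?addr0 => [|x /negPf ->]; last by rewrite mul0r.
by rewrite -powRrM divff ?gt_eqF// powRr1// Wch.1.
Qed.

Lemma renyi_minimizer (x0 : X) :
  exists2 p, is_dist p & forall p', is_dist p' -> renyi_gain p <= renyi_gain p'.
Proof.
pose A : set (X -> R) := [set p | is_dist p]%classic.
(* The truncated gain is continuous on all functions and agrees with [renyi_gain] on the simplex. *)
pose G (p : X -> R) := \sum_y Num.max (renyi_mix p y) 0 `^ a^-1.
have GE p : is_dist p -> G p = renyi_gain p.
  by move=> pd; apply: eq_bigr => y _; rewrite max_l// renyi_mix_ge0//; exact: pd.1.
have pc x : continuous (fun p : prod_topology (fun _ : X => R^o) => p x).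
  exact: proj_continuous.
have cG : continuous (G : prod_topology (fun _ : X => R^o) -> R).
  apply: continuous_big => [|y _]; first exact: add_continuous.
  move=> p; apply: (@continuous_comp _ _ _
    (fun p : prod_topology (fun _ : X => R^o) => renyi_mix p y) (fun z => Num.max z 0 `^ a^-1)).
    move: p; apply: continuous_big => [|x _]; first exact: add_continuous.
    move=> p; apply: (@continuous_comp _ _ _
      (fun p : prod_topology (fun _ : X => R^o) => p x) (fun r : R => r * W x y `^ a)).
      exact: pc.
    exact: mulrr_continuous.
  by apply: continuous_max0_powR; rewrite invr_gt0.
(* The simplex is a closed part of the unit cube, which is compact by Tychonoff's theorem. *)
have cA : compact (A : set (prod_topology (fun _ : X => R^o))).
  have -> : A = ([set p : X -> R | forall x, (`[0, 1]%classic : set R) (p x)] `&`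
                 ((fun p => \sum_x p x) @^-1` [set 1]))%classic.
    rewrite eqEsubset; split=> p /=.
      move=> [p0 p1]; split=> // x; rewrite in_itv/= p0/= -p1 (bigD1 x)//=.
      by rewrite lerDl sumr_ge0.
    by move=> [p0 p1]; split=> // x; have := p0 x; rewrite in_itv/= => /andP[].
  apply: compact_closedI.
    exact: (@tychonoff _ (fun _ : X => R^o) (fun _ => `[0, 1]%classic)
      (fun _ => @segment_compact _ _ _)).
  apply: preimage_closed; last exact: closed_eq.
  move=> p _; apply: continuous_big => [|x _]; first exact: add_continuous.
  exact: pc.
have [] := @compact_EVT_min (prod_topology (fun _ : X => R^o)) R G A _ cA.
- exists (fun x => (x == x0)%:R).
  split=> [x|]; first exact: ler0n.
  by rewrite (bigD1 x0)//= eqxx big1 ?addr0// => x /negPf ->.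
- exact: continuous_subspaceT.
move=> p /set_mem pA pm; exists p => // p' p'd.
by rewrite -!GE//; apply: pm; exact: mem_set.
Qed.

(** Moving [p] by a fraction [t] towards the point mass at [x] cannot lower the gain. The tangent
    inequality at the moved point bounds the change by [a^-1 * t * D t], so [0 <= D t] for
    [0 < t <= 1]; letting [t] tend to 0 gives [0 <= D 0], the optimality condition. *)
Lemma renyi_minimizer_kkt p x : is_dist p ->
  (forall p', is_dist p' -> renyi_gain p <= renyi_gain p') ->
  renyi_gain p <= \sum_y W x y `^ a * renyi_mix p y `^ (a^-1 - 1).
Proof.
move=> pd pm; set s := renyi_mix p.
have s0 y : 0 <= s y by apply: renyi_mix_ge0; exact: pd.1.
have ai1 : 1 < a^-1 by rewrite invf_gt1.
pose st (t : R) y := s y + t * (W x y `^ a - s y).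
pose D t := \sum_y Num.max (st t y) 0 `^ (a^-1 - 1) * (W x y `^ a - s y).
have st0 t y : 0 <= t <= 1 -> 0 <= st t y.
  move=> /andP[t0 t1]; rewrite /st.
  have -> : s y + t * (W x y `^ a - s y) = (1 - t) * s y + t * W x y `^ a by ring.
  by rewrite addr_ge0// mulr_ge0 ?powR_ge0 ?subr_ge0.
have Dt t : 0 < t -> t <= 1 -> 0 <= D t.
  move=> t0 t1; have t01 : 0 <= t <= 1 by rewrite (ltW t0).
  pose pt x' := (1 - t) * p x' + t * (x' == x)%:R.
  have ptd : is_dist pt.
    split=> [x'|].
      by rewrite addr_ge0// mulr_ge0 ?ler0n ?(ltW t0) ?subr_ge0//; exact: pd.1.
    rewrite big_split/= -!mulr_sumr pd.2 (bigD1 x)//= eqxx big1 => [|x' /negPf ->//].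
    by rewrite addr0 mulr1n; ring.
  have ptE y : renyi_mix pt y = st t y.
    rewrite /renyi_mix /st.
    under eq_bigr => x' _ do rewrite mulrDl -!mulrA.
    rewrite big_split/= -!mulr_sumr -/(renyi_mix p y) -/s.
    have -> : \sum_x' (x' == x)%:R * W x' y `^ a = W x y `^ a.
      rewrite (bigD1 x)//= eqxx mulr1n mul1r big1 ?addr0// => x' /negPf ->.
      by rewrite mul0r.
    by rewrite -/(renyi_mix p y) -/(s y); ring.
  have := pm _ ptd; rewrite -subr_ge0 /renyi_gain -sumrB.
  have : \sum_y (renyi_mix pt y `^ a^-1 - renyi_mix p y `^ a^-1) <= (a^-1 * t) * D t.
    rewrite /D mulr_sumr; apply: ler_sum => y _; rewrite ptE.
    apply: le_trans (powR_tangent _ _ _ ai1 (s0 y) (st0 _ _ t01)) _.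
    rewrite max_l ?st0// /st; rewrite le_eqVlt; apply/orP; left; apply/eqP; ring.
  move=> /[swap] /le_trans /[apply].
  by rewrite pmulr_rge0// mulr_gt0// invr_gt0.
have Dc : D @ 0^'+ --> D 0.
  apply: cvg_at_right_filter.
  apply: continuous_big => [|y _ t]; first exact: add_continuous.
  apply: (@continuous_comp _ _ _ (fun t => Num.max (st t y) 0 `^ (a^-1 - 1))
    (fun r : R => r * (W x y `^ a - s y))); last exact: mulrr_continuous.
  apply: (@continuous_comp _ _ _ (fun t => st t y)
    (fun z => Num.max z 0 `^ (a^-1 - 1))); last first.
    by apply: continuous_max0_powR; rewrite subr_gt0.
  rewrite /st; apply: cvgD; first exact: cvg_cst.
  exact: mulrr_continuous.
have D0 : 0 <= D 0.
  rewrite leNgt; apply/negP => D0.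
  have := Dc; move=> /cvgr_lt /(_ _ D0) /= H.
  have : \forall t \near (0 : R)^'+, False; last by move=> /filter_ex [].
  near=> t.
  have : D t < 0 by near: t; exact: H.
  rewrite ltNge Dt//.
  by near: t; exact: nbhs_right_le.
move: D0; rewrite /D.
under eq_bigr => y _.
  rewrite /st mul0r addr0 max_l// mulrBr [_ * s y]mulrC mulr_powRB1 ?invr_gt0//.
  over.
rewrite sumrB subr_ge0; move=> /le_trans; apply; apply: ler_sum => y _.
by rewrite mulrC.
Unshelve. all: end_near. Qed.

(** In exponential form: the order [a] divergence of every [W x] from [q] is at most the capacity.
    The center [q] is the normalized power [a^-1] of the optimal mixture. *)
Lemma renyi_center (x0 : X) : exists2 q : Y -> R, is_dist q &
  forall x, expR (- ((1 - a) * renyi_cap a W)) <= \sum_y W x y `^ a * q y `^ (1 - a).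
Proof.
have [p pd pm] := renyi_minimizer x0.
have F0 := renyi_gain_gt0 _ pd; set F := renyi_gain p in F0.
have s0 y : 0 <= renyi_mix p y by apply: renyi_mix_ge0; exact: pd.1.
exists (fun y => renyi_mix p y `^ a^-1 / F).
  split=> [y|]; first by rewrite divr_ge0 ?powR_ge0// ltW.
  by rewrite -mulr_suml divff ?gt_eqF.
(* The power [a] of the minimal gain [F] separates the two sides: the capacity controls one
   comparison, the optimality condition at [x] the other. *)
move=> x; apply: (@le_trans _ _ (F `^ a)).
  rewrite /powR (gt_eqF F0) ler_expR.
  have := renyi_info_le_cap _ pd; rewrite renyi_infoE -/F.
  have b0 : 0 < 1 - a by rewrite subr_gt0.
  rewrite -(ler_pM2l b0).
  have -> : (1 - a) * (a / (a - 1) * ln F) = - (a * ln F).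
    by field; rewrite subr_eq0 (lt_eqF a1).
  lra.
have E : F `^ a = F / F `^ (1 - a).
  apply: (canRL (mulfK _)); first by rewrite gt_eqF// powR_gt0.
  by rewrite -powRD ?(gt_eqF F0) ?implybT// addrC subrK powRr1// ltW.
rewrite E ler_pdivrMr ?powR_gt0// mulr_suml.
apply: le_trans (renyi_minimizer_kkt _ x pd pm) _.
apply: ler_sum => y _; rewrite -mulrA ler_wpM2l ?powR_ge0//.
rewrite -powRM ?divr_ge0 ?powR_ge0 ?(ltW F0)// divfK ?gt_eqF// -powRrM.
by rewrite (_ : a^-1 * (1 - a) = a^-1 - 1)//; field; rewrite gt_eqF.
Qed.

End center.

(** * Feedback path measures and change of measure *)

Section sequence_sums.
Context {R : realType} {A : finType}.
Implicit Types (n : nat) (F G : seq A -> R).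

(** Paths are lists summed from the first letter on, so that inductions can peel off the first
    step. *)
Fixpoint ssum n F : R :=
  if n is m.+1 then \sum_(a : A) ssum m (fun s => F (a :: s)) else F [::].

Lemma ssum_ext n F G : (forall s, size s = n -> F s = G s) -> ssum n F = ssum n G.
Proof.
elim: n F G => [|n IH] F G FG /=; first exact: FG.
by apply: eq_bigr => a _; apply: IH => s sn; apply: FG; rewrite /= sn.
Qed.

Lemma ler_ssum n F G : (forall s, size s = n -> F s <= G s) -> ssum n F <= ssum n G.
Proof.
elim: n F G => [|n IH] F G FG /=; first exact: FG.
by apply: ler_sum => a _; apply: IH => s sn; apply: FG; rewrite /= sn.
Qed.

Lemma ssumD n F G : ssum n (fun s => F s + G s) = ssum n F + ssum n G.
Proof.
elim: n F G => [//|n IH] F G /=; rewrite -big_split/=.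
by apply: eq_bigr => a _; exact: IH.
Qed.

Lemma ssumZ n (c : R) F : ssum n (fun s => c * F s) = c * ssum n F.
Proof.
elim: n F => [//|n IH] F /=; rewrite mulr_sumr.
by apply: eq_bigr => a _; exact: IH.
Qed.

Lemma ssum_sum (I : finType) n (F : I -> seq A -> R) :
  ssum n (fun s => \sum_i F i s) = \sum_i ssum n (F i).
Proof.
elim: n F => [//|n IH] F /=; rewrite exchange_big/=.
by apply: eq_bigr => a _; exact: IH.
Qed.

Lemma ssum_tuple n F : ssum n F = \sum_(t : n.-tuple A) F t.
Proof.
elim: n F => [|n IH] F /=.
  rewrite (bigD1 [tuple])//= big1 ?addr0// => t; by rewrite [t]tuple0 => /eqP.
under eq_bigr => a _ do rewrite IH.
rewrite pair_big/=.
rewrite (reindex (fun t : n.+1.-tuple A => (thead t, [tuple of behead t])))/=.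
  by apply: eq_bigr => t _; rewrite {3}(tuple_eta t).
exists (fun p : A * n.-tuple A => [tuple of p.1 :: p.2]) => [t _|[a t] _] /=.
  by rewrite -tuple_eta.
by rewrite theadE; congr pair; apply: val_inj.
Qed.

End sequence_sums.

Section feedback_path.
Context {R : realType} {A : finType} {E : Type}.
Implicit Types (K z : E -> A -> R) (g : seq A -> E) (s : seq A).

(** Law of a feedback path: [g] picks the kernel index from the past, and after a letter [a] the
    strategy continues as [fun u => g (a :: u)]. The index type is arbitrary, so that a letter can
    be a whole block and an index the strategy inside it. *)
Fixpoint fprod K g s : R :=
  if s is a :: s' then K (g [::]) a * fprod K (fun u => g (a :: u)) s' else 1.

Fixpoint psum z g s : R :=
  if s is a :: s' then z (g [::]) a + psum z (fun u => g (a :: u)) s' else 0.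

Lemma fprod_ge0 K g s : (forall e a, 0 <= K e a) -> 0 <= fprod K g s.
Proof. by move=> K0; elim: s g => [|a s IH] g //=; rewrite mulr_ge0. Qed.

Lemma ler_fprod K K' g s : (forall e a, 0 <= K e a <= K' e a) ->
  fprod K g s <= fprod K' g s.
Proof.
move=> KK; elim: s g => [|a s IH] g //=.
apply: ler_pM => //; first by case/andP: (KK (g [::]) a).
  by apply: fprod_ge0 => e b; case/andP: (KK e b).
by case/andP: (KK (g [::]) a).
Qed.

Lemma fprod_expR K z (r : R) g s :
  fprod (fun e a => K e a * expR (r + z e a)) g s =
  fprod K g s * expR ((size s)%:R * r + psum z g s).
Proof.
elim: s g => [|a s IH] g /=; first by rewrite mul0r addr0 expR0 mulr1.
rewrite IH mulrACA -expRD; congr (_ * expR _).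
by rewrite -[(size s).+1]addn1 natrD; ring.
Qed.

Lemma ssum_fprod K g n : (forall e, \sum_a K e a = 1) -> ssum n (fprod K g) = 1.
Proof.
move=> K1; elim: n g => [//|n IH] g /=.
by under eq_bigr => a _ do rewrite ssumZ IH mulr1.
Qed.

Section centered.
Variables (K z : E -> A -> R).
Hypotheses (K0 : forall e a, 0 <= K e a) (K1 : forall e, \sum_a K e a = 1).
Hypothesis Kz : forall e, \sum_a K e a * z e a = 0.

Lemma ssum_fprod_psum g n : ssum n (fun s => fprod K g s * psum z g s) = 0.
Proof.
elim: n g => [|n IH] g /=; first by rewrite mulr0.
under eq_bigr => a _.
  rewrite (ssum_ext _ _ (fun s => K (g [::]) a * z (g [::]) a * fprod K (fun u => g (a :: u)) s
    + K (g [::]) a * (fprod K (fun u => g (a :: u)) s * psum z (fun u => g (a :: u)) s))).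
    by rewrite ssumD !ssumZ IH ssum_fprod// mulr0 addr0 mulr1; over.
  by move=> s _ /=; ring.
exact: Kz.
Qed.

(* Martingale orthogonality: the cross terms vanish. *)
Lemma ssum_fprod_psum2 (B : R) g n :
  (forall e, \sum_a K e a * z e a ^+ 2 <= B) ->
  ssum n (fun s => fprod K g s * psum z g s ^+ 2) <= n%:R * B.
Proof.
move=> KB; elim: n g => [|n IH] g /=; first by rewrite expr0n/= mulr0 mul0r.
apply: (@le_trans _ _ (\sum_a (K (g [::]) a * z (g [::]) a ^+ 2 + K (g [::]) a * (n%:R * B)))).
  apply: ler_sum => a _.
  rewrite (ssum_ext _ _ (fun s => (K (g [::]) a * z (g [::]) a ^+ 2 * fprod K (fun u => g (a :: u)) s
    + 2 * K (g [::]) a * z (g [::]) a * (fprod K (fun u => g (a :: u)) s * psum z (fun u => g (a :: u)) s))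
    + K (g [::]) a * (fprod K (fun u => g (a :: u)) s * psum z (fun u => g (a :: u)) s ^+ 2))).
    rewrite !ssumD !ssumZ ssum_fprod_psum ssum_fprod// mulr0 addr0 mulr1 lerD2l.
    by rewrite ler_wpM2l.
  by move=> s _ /=; ring.
rewrite big_split/= -mulr_suml K1 mul1r -[n.+1]addn1 natrD mulrDl mul1r addrC.
by rewrite lerD2l.
Qed.

Lemma chebyshev_psum (B s0 : R) g n : 0 < s0 ->
  (forall e, \sum_a K e a * z e a ^+ 2 <= B) ->
  ssum n (fun s => fprod K g s * (s0 < psum z g s)%R%:R) <= n%:R * B / s0 ^+ 2.
Proof.
move=> s00 KB; rewrite ler_pdivlMr ?exprn_gt0// mulrC.
apply: le_trans (ssum_fprod_psum2 _ g n KB); rewrite -ssumZ.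
apply: ler_ssum => s _; rewrite mulrCA ler_wpM2l ?fprod_ge0//.
have [H|_] := ltP s0; last by rewrite mulr0 sqr_ge0.
by rewrite mulr1 lerXn2r ?nnegrE// ltW// (lt_trans s00).
Qed.

End centered.

End feedback_path.

Section change_of_measure.
Context {R : realType} {A : finType} {E : Type}.
Variables (w v z1 z2 : E -> A -> R) (q : A -> R) (rho eps B : R).
Hypotheses (w0 : forall e a, 0 <= w e a) (v0 : forall e a, 0 <= v e a).
Hypotheses (v1 : forall e, \sum_a v e a = 1).
Hypotheses (vz1 : forall e, \sum_a v e a * z1 e a = 0)
  (vz2 : forall e, \sum_a v e a * z2 e a = 0)
  (vB1 : forall e, \sum_a v e a * z1 e a ^+ 2 <= B)
  (vB2 : forall e, \sum_a v e a * z2 e a ^+ 2 <= B).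
Hypotheses (q0 : forall a, 0 <= q a) (q1 : \sum_a q a = 1).
Hypothesis vq : forall e a, v e a <= q a * expR (rho + z1 e a).
Hypothesis vw : forall e a, v e a <= w e a * expR (eps + z2 e a).

Let qE (e : E) a := q a.

(** The total [v]-mass 1 is split into two deviation events, each bounded by Chebyshev, and the
    remaining paths. On these, [v] is compared with [q] inside [S] and with [w] outside [S], at the
    price of [s0] in each exponent. In the application [S] is correct decoding. *)
Lemma change_of_measure (g : seq A -> E) (n : nat) (S : seq A -> bool) (s0 : R) :
  0 < s0 ->
  expR (- (n%:R * eps + s0)) * (1 - 2 * (n%:R * B / s0 ^+ 2)
     - expR (n%:R * rho + s0) * ssum n (fun s => fprod qE g s * (S s)%:R)) <=
  ssum n (fun s => fprod w g s * (~~ S s)%:R).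
Proof.
move=> s00.
have P1 := chebyshev_psum _ _ v0 v1 vz1 B s0 g n s00 vB1.
have P2 := chebyshev_psum _ _ v0 v1 vz2 B s0 g n s00 vB2.
have V1 : ssum n (fprod v g) = 1 by apply: ssum_fprod.
have : ssum n (fprod v g) <= ssum n (fun s =>
   (fprod v g s * (s0 < psum z1 g s)%R%:R + fprod v g s * (s0 < psum z2 g s)%R%:R)
   + (expR (n%:R * rho + s0) * (fprod qE g s * (S s)%:R)
   + expR (n%:R * eps + s0) * (fprod w g s * (~~ S s)%:R))).
  apply: ler_ssum => s sn.
  have F0 := fprod_ge0 _ g s v0.
  have Q0 : 0 <= fprod qE g s by apply: fprod_ge0 => e a; exact: q0.
  have W0 := fprod_ge0 _ g s w0.
  have FQ : fprod v g s <= fprod qE g s * expR (n%:R * rho + psum z1 g s).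
    rewrite -sn -fprod_expR; apply: ler_fprod => e a.
    by rewrite v0 vq.
  have FW : fprod v g s <= fprod w g s * expR (n%:R * eps + psum z2 g s).
    rewrite -sn -fprod_expR; apply: ler_fprod => e a.
    by rewrite v0 vw.
  have X1 := expR_ge0 (n%:R * rho + s0); have X2 := expR_ge0 (n%:R * eps + s0).
  have N1 := mulr_ge0 X1 Q0; have N2 := mulr_ge0 X2 W0.
  have [T1|T1] := ltP s0 (psum z1 g s); have [T2|T2] := ltP s0 (psum z2 g s);
    case: (S s); rewrite /= ?mulr0 ?mulr1 ?addr0 ?add0r; try lra.
    rewrite mulrC; apply: le_trans FQ _; rewrite ler_wpM2l// ler_expR; lra.
  rewrite mulrC; apply: le_trans FW _; rewrite ler_wpM2l// ler_expR; lra.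
rewrite !ssumD !ssumZ V1 => H.
rewrite expRN mulrC ler_pdivrMr ?expR_gt0// [leRHS]mulrC; lra.
Qed.

Lemma ssum_fprod_q (g g' : seq A -> E) s : fprod qE g s = fprod qE g' s.
Proof. by elim: s g g' => [//|a s IH] g g' /=; rewrite (IH _ (fun u => g' (a :: u))). Qed.

(** The [q]-law of a path is the same for every message, and each path is decoded to [L] messages,
    so the [q]-probability of correct decoding averages to [L / M]. *)
Lemma feedback_code_error (M L n : nat) (g : 'I_M -> seq A -> E)
    (dec : seq A -> {set 'I_M}) (s0 : R) :
  (0 < M)%N -> (forall s, #|dec s| = L) -> 0 < s0 ->
  expR (- (n%:R * eps + s0)) * (1 - 2 * (n%:R * B / s0 ^+ 2)
     - expR (n%:R * rho + s0) * (L%:R / M%:R)) <=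
  M%:R^-1 * \sum_m ssum n (fun s => fprod w (g m) s * (m \notin dec s)%:R).
Proof.
move=> M0 decL s00; have M0' : 0 < M%:R :> R by rewrite ltr0n.
rewrite [leRHS]mulrC ler_pdivlMr//.
have -> : expR (- (n%:R * eps + s0)) * (1 - 2 * (n%:R * B / s0 ^+ 2)
     - expR (n%:R * rho + s0) * (L%:R / M%:R)) * M%:R =
  \sum_m expR (- (n%:R * eps + s0)) * (1 - 2 * (n%:R * B / s0 ^+ 2)
     - expR (n%:R * rho + s0) * ssum n (fun s => fprod qE (g m) s * (m \in dec s)%:R)).
  rewrite -mulr_sumr -mulrA; congr (_ * _).
  rewrite sumrB sumr_const card_ord mulrBl -mulr_sumr.
  congr (_ - _); first by rewrite [LHS]mulr_natr.
  rewrite -mulrA divfK ?gt_eqF//; congr (_ * _).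
  pose m0 := Ordinal M0.
  rewrite -ssum_sum (ssum_ext _ _ (fun s => L%:R * fprod qE (g m0) s)).
    by rewrite ssumZ ssum_fprod ?mulr1.
  move=> s _; under eq_bigr => m _ do rewrite (ssum_fprod_q _ (g m0)).
  rewrite -mulr_sumr mulrC; congr (_ * _).
  by rewrite -(decL s) -sum1_card natr_sum [RHS]big_mkcond/=; apply: eq_bigr => m _; case: ifP.
by apply: ler_sum => m _; exact: change_of_measure.
Qed.

End change_of_measure.

(** * Tilting with an adapted order *)

(** Convexity of the exponential between [x] and 0: the bounds [H1] and [H2] come from tangent lines
    at [t * x], and their linear terms cancel with weights [t] and [1 - t]. *)
Lemma expR_jensen {R : realType} (t x : R) : 0 <= t <= 1 ->
  expR (t * x) <= t * expR x + (1 - t).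
Proof.
move=> /andP[t0 t1].
have H1 : expR (t * x) * (1 + (1 - t) * x) <= expR x.
  have -> : expR x = expR (t * x) * expR ((1 - t) * x) by rewrite -expRD; congr expR; ring.
  by rewrite ler_wpM2l ?expR_ge0// expR_ge1Dx.
have H2 : expR (t * x) * (1 - t * x) <= 1.
  by rewrite -[leRHS](expRxMexpNx_1 (t * x)) ler_wpM2l ?expR_ge0// expR_ge1Dx.
have t1' : 0 <= 1 - t by rewrite subr_ge0.
have := ler_wpM2l t0 H1; have := ler_wpM2l t1' H2; nra.
Qed.

Section tilting.
Context {R : realType} {A : finType}.
Variables (w q : A -> R) (c : R).
Hypotheses (w0 : forall a, 0 <= w a) (w1 : \sum_a w a = 1).
Hypotheses (q0 : forall a, 0 < q a) (q1 : \sum_a q a = 1).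

Let l a := ln (w a) - ln (q a).
Hypothesis lc : forall a, 0 < w a -> `|l a| <= c.

Definition tilt_sum (b : R) : R := \sum_a w a `^ b * q a `^ (1 - b).

(** Restricting to the support of [w] allows exponentials in place of powers: the sum agrees with
    [tilt_sum] for positive orders and is continuous at every order. *)
Let S (b : R) := \sum_(a | 0 < w a) q a * expR (b * l a).

Let u (b : R) a : R := if 0 < w a then q a * expR (b * l a) else 0.

Let SE b : S b = \sum_a u b a.
Proof. by rewrite /S big_mkcond. Qed.

Let tilt_sumE b : 0 < b -> tilt_sum b = S b.
Proof.
move=> b0; rewrite SE; apply: eq_bigr => a _; rewrite /u.
case: ifPn => wa; last first.
  suff -> : w a = 0 by rewrite powR0 ?gt_eqF// mul0r.
  by apply/eqP; rewrite eq_le w0 andbT leNgt.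
rewrite /powR (gt_eqF wa) (gt_eqF (q0 a)) -expRD.
rewrite -{2}(lnK (q0 a : q a \in Num.pos)) -expRD; congr expR; rewrite /l; ring.
Qed.

Let u_ge0 b a : 0 <= u b a.
Proof. by rewrite /u; case: ifP => // _; rewrite mulr_ge0 ?expR_ge0// ltW. Qed.

Let S_gt0 b : 0 < S b.
Proof.
have [a wa] : exists a, 0 < w a.
  apply: contrapT => /forallNP H; move: w1; rewrite big1 => [/eqP|a _].
    by rewrite eq_sym oner_eq0.
  by apply/eqP; rewrite eq_le w0 andbT leNgt; apply/negP/H.
rewrite SE (bigD1 a)//= ltr_pwDl ?sumr_ge0// /u wa.
by rewrite mulr_gt0 ?expR_gt0.
Qed.

Let u1 a : u 1 a = w a.
Proof.
rewrite /u; case: ifPn => wa; last first.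
  by apply/eqP; rewrite eq_le w0 leNgt wa.
by rewrite mul1r /l expRB !lnK ?posrE// mulrC divfK// gt_eqF.
Qed.

Let S1 : S 1 = 1.
Proof. by rewrite SE -[RHS]w1; apply: eq_bigr => a _; exact: u1. Qed.

(* [- ln (tilt_sum b) / b] is nonincreasing in [b]. *)
Let ln_S_mono b b' : 0 < b -> b <= b' -> - ln (S b') / b' <= - ln (S b) / b.
Proof.
move=> b0 bb'; have b'0 : 0 < b' by exact: lt_le_trans bb'.
pose t := b / b'.
have t01 : 0 <= t <= 1.
  by apply/andP; split; [rewrite divr_ge0 ?ltW|rewrite ler_pdivrMr// mul1r].
(* Jensen with [t = b / b'] is applied to the ratio normalized by [S b']; the bound closes because
   [q] has mass at most 1 on the support of [w]. *)
have : S b <= expR (t * ln (S b')).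
  have : \sum_(a | 0 < w a) q a * expR (t * (b' * l a - ln (S b'))) <=
      \sum_(a | 0 < w a) (t * (q a * expR (b' * l a)) / S b' + (1 - t) * q a).
    apply: ler_sum => a _.
    apply: le_trans (ler_wpM2l (ltW (q0 a)) (expR_jensen _ (b' * l a - ln (S b')) t01)) _.
    rewrite expRB lnK ?posrE// le_eqVlt; apply/orP; left; apply/eqP.
    by field; rewrite gt_eqF.
  rewrite big_split/= -mulr_suml -!mulr_sumr -/(S b') -mulrA divff ?gt_eqF// mulr1 => H.
  have : \sum_(a | 0 < w a) q a * expR (t * (b' * l a - ln (S b'))) <= 1.
    apply: le_trans H _.
    have : \sum_(a | 0 < w a) q a <= 1.
      rewrite -q1 big_mkcond; apply: ler_sum => a _.
      by case: ifP => // _; exact: ltW.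
    have : 0 <= 1 - t by rewrite subr_ge0; case/andP: t01.
    by move=> t0 /(ler_wpM2l t0); rewrite mulr1; lra.
  have -> : \sum_(a | 0 < w a) q a * expR (t * (b' * l a - ln (S b'))) =
      S b / expR (t * ln (S b')).
    rewrite /S mulr_suml; apply: eq_bigr => a _.
    rewrite -expRN -mulrA -expRD; congr (_ * expR _).
    by rewrite /t; field; rewrite gt_eqF.
  by rewrite ler_pdivrMr ?expR_gt0// mul1r.
rewrite -{1}(lnK (S_gt0 b : S b \in Num.pos)) ler_expR => H.
rewrite ler_pdivlMr// (_ : - ln (S b') / b' * b = - (t * ln (S b'))) ?lerN2//.
by rewrite /t; ring.
Qed.

Let m (b : R) := (\sum_a u b a * l a) / S b.
Let v b a := u b a / S b.

Let v_sum b : \sum_a v b a = 1.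
Proof. by rewrite -mulr_suml -SE divff// gt_eqF. Qed.

Let v_ge0 b a : 0 <= v b a.
Proof. by rewrite divr_ge0 ?u_ge0 ?(ltW (S_gt0 b)). Qed.

Let v_mean b : \sum_a v b a * (l a - m b) = 0.
Proof.
under eq_bigr => a _ do rewrite mulrBr.
rewrite sumrB -mulr_suml v_sum mul1r /m mulr_suml.
by apply/eqP; rewrite subr_eq0; apply/eqP/eq_bigr => a _; rewrite /v mulrAC.
Qed.

Let m_bound b : `|m b| <= c.
Proof.
rewrite normrM normfV (gtr0_norm (S_gt0 b)) ler_pdivrMr//.
apply: le_trans (ler_norm_sum _ _ _) _.
rewrite SE mulr_sumr; apply: ler_sum => a _.
rewrite normrM ger0_norm ?u_ge0// mulrC.
rewrite /u; case: ifP => wa; last by rewrite !mulr0.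
by rewrite ler_wpM2r ?lc// mulr_ge0 ?expR_ge0// ltW.
Qed.

Let v_var b (k : R) : `|k| <= 1 -> \sum_a v b a * (k * (l a - m b)) ^+ 2 <= (2 * c) ^+ 2.
Proof.
move=> k1; have -> : (2 * c) ^+ 2 = \sum_a v b a * (2 * c) ^+ 2.
  by rewrite -mulr_suml v_sum mul1r.
apply: ler_sum => a _; rewrite /v /u; case: ifP => wa; last by rewrite !mul0r.
rewrite ler_wpM2l//.
  by rewrite divr_ge0 ?(ltW (S_gt0 b))// mulr_ge0 ?expR_ge0// ltW.
have H := lc _ wa; have H2 := m_bound b.
have H3 : `|l a - m b| <= 2 * c by apply: le_trans (ler_normB _ _) _; lra.
have c0 : 0 <= 2 * c by apply: le_trans H3; exact: normr_ge0.
rewrite -[leLHS]real_normK ?num_real//; apply: lerXn2r; rewrite ?nnegrE// normrM.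
by rewrite -[leRHS]mul1r ler_pM.
Qed.

(* The divergence of the tilted measure [v b] from [q]; that from [w] is
   [(b - 1) * m b - ln (S b)]. *)
Let h b := b * m b - ln (S b).

(** Gibbs' inequality for [v b] against [w], whose log-ratio is [(b - 1) * l a - ln (S b)]: the
    bound [1 - x <= expR (- x)] is averaged under [v b]. *)
Let dw_ge0 b : 0 <= (b - 1) * m b - ln (S b).
Proof.
have : \sum_a v b a * (1 - ((b - 1) * l a - ln (S b))) <= 1.
  rewrite -[leRHS]w1; apply: ler_sum => a _.
  rewrite /v -(u1 a) /u; case: ifP => wa; last by rewrite !mul0r.
  have -> : q a * expR (1 * l a) =
    q a * expR (b * l a) / S b * expR (- ((b - 1) * l a - ln (S b))).
    rewrite expRN expRB lnK ?posrE// -[in LHS](_ : b * l a - (b - 1) * l a = 1 * l a); last by ring.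
    by rewrite expRB; field; rewrite !gt_eqF ?expR_gt0.
  rewrite ler_wpM2l ?expR_ge1Dx//.
  by rewrite divr_ge0 ?(ltW (S_gt0 b))// mulr_ge0 ?expR_ge0// ltW.
have -> : \sum_a v b a * (1 - ((b - 1) * l a - ln (S b))) =
  \sum_a (v b a * (1 - ((b - 1) * m b - ln (S b))) - (b - 1) * (v b a * (l a - m b))).
  by apply: eq_bigr => a _; ring.
rewrite sumrB -mulr_suml -[X in _ - X <= _]mulr_sumr v_mean v_sum; lra.
Qed.

Let h_continuous : continuous h.
Proof.
have uc a : continuous (u ^~ a).
  rewrite /u; case: (0 < w a) => b; last exact: cvg_cst.
  apply: cvgM; first exact: cvg_cst.
  apply: (@continuous_comp _ _ _ (fun b : R => b * l a) expR); last exact: continuous_expR.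
  exact: mulrr_continuous.
have Sc : continuous S.
  rewrite (_ : S = fun b => \sum_a u b a); last by apply/funext => b; exact: SE.
  by apply: continuous_big => [|a _]; [exact: add_continuous|exact: uc].
move=> b; apply: cvgB.
  apply: cvgM; first exact: cvg_id.
  apply: cvgM; last by apply: cvgV; [rewrite gt_eqF|exact: Sc].
  move: b; apply: continuous_big => [|a _]; first exact: add_continuous.
  move=> b; apply: (@continuous_comp _ _ _ (u ^~ a) (fun r : R => r * l a)).
    exact: uc.
  exact: mulrr_continuous.
by apply: continuous_cvg; [exact: continuous_ln|exact: Sc].
Qed.

(** Take [v] tilted at a well chosen order [b]; [z1] and [z2] are the centered log-ratios of [v] to
    [q] and to [w], so only their means, the two divergences, must be compared with [rho] and [eps].
    The order [b'] leaves room for a grid below [b]. *)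
Lemma tilted_kernel (a0 rho eps : R) : 0 < a0 < 1 -> 0 <= eps ->
  - ln (tilt_sum a0) <= (1 - a0) * rho ->
  (forall b, a0 <= b <= 1 -> exists2 b', 0 < b' <= b &
    - ln (tilt_sum b') / b' - (1 - b) / b * rho <= eps) ->
  exists v z1 z2 : A -> R,
    [/\ [/\ forall a, 0 <= v a, \sum_a v a = 1,
          \sum_a v a * z1 a = 0 & \sum_a v a * z2 a = 0],
        \sum_a v a * z1 a ^+ 2 <= (2 * c) ^+ 2,
        \sum_a v a * z2 a ^+ 2 <= (2 * c) ^+ 2,
        forall a, v a <= q a * expR (rho + z1 a) &
        forall a, v a <= w a * expR (eps + z2 a)].
Proof.
move=> /andP[a00 a01] eps0 H0 Heps.
suff [b /andP[ab b1] [hb db]] : exists2 b, a0 <= b <= 1 &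
    h b <= rho /\ (b - 1) * m b - ln (S b) <= eps.
  have b0 : 0 < b by exact: lt_le_trans ab.
  exists (v b), (fun a => b * (l a - m b)), (fun a => (b - 1) * (l a - m b)).
  have M k : \sum_a v b a * (k * (l a - m b)) = 0.
    under eq_bigr => a _ do rewrite mulrCA.
    by rewrite -mulr_sumr v_mean mulr0.
  split; [by split=> // a; exact: v_ge0| | | |].
  - by apply: v_var; rewrite ger0_norm// ltW.
  - by apply: v_var; rewrite ler0_norm; lra.
  - move=> a; rewrite /v /u; case: ifP => _; last first.
      by rewrite mul0r mulr_ge0 ?expR_ge0// ltW.
    rewrite -mulrA ler_pM2l// -{1}(lnK (S_gt0 b : S b \in Num.pos)) -expRB ler_expR.
    by move: hb; rewrite /h; lra.
  - move=> a; rewrite -(u1 a) /v /u; case: ifP => _; last by rewrite !mul0r.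
    rewrite -!mulrA ler_pM2l// -{1}(lnK (S_gt0 b : S b \in Num.pos)) -expRB -expRD ler_expR.
    by lra.
have [h1|h1] := leP (h 1) rho.
  by exists 1; [rewrite lexx ltW|rewrite h1 subrr mul0r S1 ln1 subrr eps0].
(* After multiplication by [1 - a0], the comparison of [h a0] with [- ln (S a0)] is [a0] times
   [dw_ge0]. *)
have h0 : h a0 <= rho.
  move: H0; rewrite tilt_sumE// => H0.
  have b0 : 0 < 1 - a0 by rewrite subr_gt0.
  rewrite -(ler_pM2l b0); apply: le_trans H0.
  by have := dw_ge0 a0; rewrite /h; nra.
have [|b] := @IVT R h a0 1 rho (ltW a01) (continuous_subspaceT h_continuous).
  by rewrite ge_min h0/= le_max (ltW h1) orbT.
rewrite in_itv/= => ab hb; exists b => //; split; first by rewrite hb.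
have [b' /andP[b'0 b'b] He] := Heps _ ab.
apply: le_trans He; case/andP: ab => ab b1; have b0 : 0 < b by exact: lt_le_trans ab.
(* Since [h b = rho], the divergence from [w] equals [- ln (S b) / b - (1 - b) / b * rho];
   monotonicity then replaces [b] by [b'] in the first term. *)
rewrite tilt_sumE//; apply: le_trans (lerB (ln_S_mono _ _ b'0 b'b) (lexx _)).
rewrite -hb /h le_eqVlt; apply/orP; left; apply/eqP.
by field; rewrite gt_eqF.
Qed.

End tilting.

(** * Block channels *)

Section blocks.
Context {R : realType} {X Y : finType}.

Definition iid (q : Y -> R) (s : seq Y) : R := \prod_(y <- s) q y.

Lemma ssum_iid (q : Y -> R) n : \sum_y q y = 1 -> ssum n (iid q) = 1.
Proof.
move=> q1; elim: n => [|n IH] /=; first by rewrite /iid big_nil.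
rewrite -[RHS]q1; apply: eq_bigr => y _.
rewrite (ssum_ext _ _ (fun s => q y * iid q s)); first by rewrite ssumZ IH mulr1.
by move=> s _; rewrite /iid big_cons.
Qed.

Lemma iid_ge0 (q : Y -> R) s : (forall y, 0 <= q y) -> 0 <= iid q s.
Proof. by move=> q0; apply: prodr_ge0. Qed.

(** The one-letter bound holds for every input, hence for whichever input the feedback selects, and
    so it multiplies along the path. *)
Lemma ssum_renyi_ge (W : X -> Y -> R) (q : Y -> R) (b r : R) (e : seq Y -> X) n :
  (forall x y, 0 <= W x y) -> (forall y, 0 <= q y) -> 0 <= r ->
  (forall x, r <= \sum_y W x y `^ b * q y `^ (1 - b)) ->
  r ^+ n <= ssum n (fun s => fprod W e s `^ b * iid q s `^ (1 - b)).
Proof.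
move=> W0 q0 r0 Hr; elim: n e => [|n IH] e /=.
  by rewrite /iid big_nil !powR1 mulr1.
rewrite exprS; apply: le_trans (ler_wpM2r (exprn_ge0 n r0) (Hr (e [::]))) _.
rewrite mulr_suml; apply: ler_sum => y _.
rewrite (ssum_ext _ _ (fun s => (W (e [::]) y `^ b * q y `^ (1 - b)) *
  (fprod W (fun u => e (y :: u)) s `^ b * iid q s `^ (1 - b)))).
  by rewrite ssumZ ler_wpM2l ?mulr_ge0 ?powR_ge0.
move=> s _; rewrite /iid big_cons !powRM ?iid_ge0 ?fprod_ge0//; first by ring.
Qed.

Definition mixture {I : finType} (q : I -> Y -> R) (s : seq Y) : R :=
  #|I|%:R^-1 * \sum_i iid (q i) s.

Lemma ssum_mixture (I : finType) (q : I -> Y -> R) n : (0 < #|I|)%N ->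
  (forall i, is_dist (q i)) -> ssum n (mixture q) = 1.
Proof.
move=> I0 qd; rewrite ssumZ ssum_sum.
under eq_bigr => i _ do rewrite ssum_iid ?(qd i).2//.
by rewrite sumr_const -[_ *+ _]mulr_natr mul1r mulVf// pnatr_eq0 -lt0n.
Qed.

Lemma mixture_ge (I : finType) (q : I -> Y -> R) i s :
  (forall i, is_dist (q i)) -> #|I|%:R^-1 * iid (q i) s <= mixture q s.
Proof.
move=> qd; rewrite /mixture ler_wpM2l ?invr_ge0// (bigD1 i)//= lerDl.
by apply: sumr_ge0 => j _; apply: iid_ge0; exact: (qd j).1.
Qed.

(** Per-letter bound on the block log-likelihood ratios. Zero entries of [W] contribute nothing as
    [ln 0 = 0]; [ln #|Y|] comes from the uniform component of the mixture, and 1 absorbs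
    [ln k.+1 <= k]. *)
Definition letter_bound (W : X -> Y -> R) : R :=
  \sum_x \sum_y `|ln (W x y)| + ln #|Y|%:R + 1.

Lemma fprod_gt0_bound (W : X -> Y -> R) e s : is_channel W -> 0 < fprod W e s ->
  - ((size s)%:R * \sum_x \sum_y `|ln (W x y)|) <= ln (fprod W e s) <= 0.
Proof.
move=> Wch; elim: s e => [|y s IH] e /=; first by rewrite ln1 mul0r oppr0 lexx.
move=> H; have W0 := Wch.1 (e [::]) y.
have F0 := fprod_ge0 _ (fun u => e (y :: u)) s Wch.1.
have Wp : 0 < W (e [::]) y.
  by rewrite lt_neqAle eq_sym W0 andbT; apply: contraTneq H => ->; rewrite mul0r ltxx.
move: H; rewrite pmulr_rgt0// => Fp.
have /andP[L1 L2] := IH _ Fp.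
rewrite lnM ?posrE//; apply/andP; split.
  rewrite -[(size s).+1]addn1 natrD mulrDl mul1r opprD addrC lerD//.
  rewrite lerNl; apply: le_trans (ler_norm _) _; rewrite normrN.
  rewrite (bigD1 (e [::]))//= (bigD1 y)//= -addrA lerDl addr_ge0//; apply: sumr_ge0 => // i _.
  exact: sumr_ge0.
rewrite -[leRHS]addr0 lerD// ln_le0//; exact: channel_le1.
Qed.

Lemma grid_cell (k : nat) (y : R) : (0 < k)%N -> 0 <= y -> y <= k%:R ->
  exists i : 'I_k, i%:R <= y <= i.+1%:R.
Proof.
elim: k => [//|k IH] _ y0 yk.
have [yk'|yk'] := leP y k%:R; last by exists ord_max; rewrite /= (ltW yk') yk.
have [k0|k0] := posnP k.
  by exists ord0; rewrite /= y0/= (le_trans yk')// k0.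
have [i hi] := IH k0 y0 yk'.
by exists (widen_ord (leqnSn k) i).
Qed.

(** One law [q] must serve all strategies inside the block and all orders, because the order is
    chosen only after the strategy [e] is known. *)
Lemma block_kernel (W : X -> Y -> R) (x0 : X) (y0 : Y) (k : nat) (a0 rho eps : R) :
  is_channel W -> (0 < k)%N -> 0 < a0 -> a0 < 1 -> 0 <= eps -> 0 <= rho ->
  k%:R * renyi_cap a0 W + ln k.+1%:R <= rho ->
  (forall b, a0 <= b < 1 ->
    (1 - b) / b * (k%:R * renyi_cap b W + ln k.+1%:R - rho) + rho / (k%:R * a0 ^+ 2) <= eps) ->
  exists2 q : k.-tuple Y -> R, (forall t, 0 < q t) /\ \sum_t q t = 1 &
  forall e : seq Y -> X, exists v z1 z2 : k.-tuple Y -> R,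
    [/\ [/\ forall a, 0 <= v a, \sum_a v a = 1,
          \sum_a v a * z1 a = 0 & \sum_a v a * z2 a = 0],
        \sum_a v a * z1 a ^+ 2 <= (2 * (k%:R * letter_bound W)) ^+ 2,
        \sum_a v a * z2 a ^+ 2 <= (2 * (k%:R * letter_bound W)) ^+ 2,
        forall a, v a <= q a * expR (rho + z1 a) &
        forall a, v a <= fprod W e a * expR (eps + z2 a)].
Proof.
move=> Wch k0 a00 a01 eps0 rho0 H0 Heps.
have k0' : 0 < k%:R :> R by rewrite ltr0n.
pose g (i : 'I_k) := a0 + (1 - a0) * (i%:R / k%:R).
have g0 i : a0 <= g i.
  by rewrite lerDl mulr_ge0 ?divr_ge0// subr_ge0 ltW.
have g1 i : g i < 1.
  have : i%:R / k%:R < 1 :> R by rewrite ltr_pdivrMr// mul1r ltr_nat.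
  have : 0 < 1 - a0 by rewrite subr_gt0.
  rewrite /g; nra.
have gp i : 0 < g i by exact: lt_le_trans (g0 i).
have /choice[qs Hqs] : forall i, exists q, is_dist q /\
    forall x, expR (- ((1 - g i) * renyi_cap (g i) W)) <= \sum_y W x y `^ g i * q y `^ (1 - g i).
  by move=> i; have [q qd qc] := renyi_center W (g i) Wch (gp i) (g1 i) x0; exists q.
have Y0 : (0 < #|Y|)%N by apply/card_gt0P; exists y0.
have Y0' : 0 < #|Y|%:R :> R by rewrite ltr0n.
(* The uniform component [None] makes the mixture positive everywhere, with a lower bound
   exponential in [k]. *)
pose Q (i : option 'I_k) := if i is Some j then qs j else fun=> #|Y|%:R^-1.
have Qd i : is_dist (Q i).
  case: i => [i|]; first exact: (Hqs i).1.
  split=> [y|]; first by rewrite invr_ge0.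
  by rewrite sumr_const -[_ *+ _]mulr_natr mulVf// gt_eqF.
have cI : #|{: option 'I_k}| = k.+1 by rewrite card_option card_ord.
have k1p : 0 < k.+1%:R :> R by rewrite ltr0n.
have qp (t : seq Y) : 0 < mixture Q t.
  apply: lt_le_trans (mixture_ge _ Q None t Qd).
  rewrite mulr_gt0 ?invr_gt0 ?cI//; apply: prodr_gt0 => y _; by rewrite invr_gt0.
have q1 : \sum_(t : k.-tuple Y) mixture Q t = 1.
  by rewrite -ssum_tuple ssum_mixture// cI.
have q1' (t : k.-tuple Y) : mixture Q t <= 1.
  by rewrite -q1 (bigD1 t)//= lerDl; apply: sumr_ge0 => u _; exact: ltW.
exists (fun t => mixture Q t) => [//|e].
have fp0 (t : k.-tuple Y) : 0 <= fprod W e t by apply: fprod_ge0; exact: Wch.1.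
have lk : ln k.+1%:R <= k%:R :> R.
  by rewrite -[k.+1]addn1 natrD addrC le_ln1Dx// (lt_le_trans _ (ler0n _ _))// ltrN10.
(* Each center has weight [1 / k.+1] in the mixture, which costs [ln k.+1] in divergence. *)
have Tb i : - ln (tilt_sum (fun t : k.-tuple Y => fprod W e t) (fun t => mixture Q t) (g i)) <=
    (1 - g i) * (k%:R * renyi_cap (g i) W + ln k.+1%:R).
  set C := renyi_cap (g i) W.
  have b0 : 0 < 1 - g i by rewrite subr_gt0.
  have T : k.+1%:R^-1 `^ (1 - g i) * expR (- ((1 - g i) * C)) ^+ k <=
      tilt_sum (fun t : k.-tuple Y => fprod W e t) (fun t => mixture Q t) (g i).
    apply: le_trans (ler_wpM2l (powR_ge0 _ _)
      (ssum_renyi_ge W (qs i) (g i) _ e k Wch.1 (Hqs i).1.1 (expR_ge0 _) (Hqs i).2)) _.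
    rewrite -ssumZ ssum_tuple; apply: ler_sum => t _.
    rewrite mulrCA ler_wpM2l ?powR_ge0// -powRM ?invr_ge0 ?iid_ge0//; last exact: (Hqs i).1.1.
    apply: ge0_ler_powR; rewrite ?nnegrE ?(ltW b0) ?(ltW (qp _))//.
      by rewrite mulr_ge0 ?invr_ge0 ?iid_ge0//; exact: (Hqs i).1.1.
    by rewrite -cI; exact: (mixture_ge _ Q (Some i)).
  have P0 : 0 < k.+1%:R^-1 `^ (1 - g i) * expR (- ((1 - g i) * C)) ^+ k.
    by rewrite mulr_gt0 ?powR_gt0 ?exprn_gt0 ?expR_gt0 ?invr_gt0.
  have := T; rewrite -ler_ln ?posrE ?(lt_le_trans P0 T)//.
  rewrite lnM ?posrE ?powR_gt0 ?exprn_gt0 ?expR_gt0 ?invr_gt0//.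
  rewrite ln_powR lnV ?posrE// -expRM_natl expRK; lra.
apply: (tilted_kernel (fun t : k.-tuple Y => fprod W e t) (fun t => mixture Q t)
  (k%:R * letter_bound W) _ _ _ _ _ a0 rho eps) => //.
- by rewrite -ssum_tuple ssum_fprod//; exact: Wch.2.
- move=> t wt.
  have /andP[L1 L2] := fprod_gt0_bound W e t Wch wt.
  have M1 : ln (mixture Q t) <= 0 by rewrite ln_le0.
  have M2 : - (k%:R * ln #|Y|%:R + ln k.+1%:R) <= ln (mixture Q t).
    have T := mixture_ge _ Q None t Qd.
    have P0 : 0 < #|{: option 'I_k}|%:R^-1 * iid (Q None) t.
      rewrite mulr_gt0 ?invr_gt0 ?cI//; apply: prodr_gt0 => y _; by rewrite invr_gt0.
    move: T; rewrite -ler_ln ?posrE//; apply: le_trans.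
    rewrite /iid /= big_const_seq count_predT size_tuple iter_mulr_1 cI.
    rewrite lnM ?posrE ?invr_gt0 ?exprn_gt0 ?invr_gt0// lnXn ?invr_gt0//.
    by rewrite !lnV ?posrE// -mulr_natl; lra.
  rewrite size_tuple in L1.
  rewrite ler_norml /letter_bound; lra.
- by rewrite a00.
- have := Tb (Ordinal k0); rewrite /g /= mul0r mulr0 addr0 => /le_trans; apply.
  by rewrite ler_wpM2l// subr_ge0 ltW.
move=> b /andP[ab b1].
have b0 : 0 < b by exact: lt_le_trans ab.
have c0 : 0 < 1 - a0 by rewrite subr_gt0.
(* The grid point just below [b] lies within [1 / k] of it; for [b = 1] it is the last one, still
   below 1. *)
have [||i /andP[i1 i2]] := grid_cell k ((b - a0) / (1 - a0) * k%:R) k0.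
- by rewrite mulr_ge0// divr_ge0 ?subr_ge0// ltW.
- by rewrite -[leRHS]mul1r ler_wpM2r// ler_pdivrMr// mul1r lerD2r.
have gb : g i <= b.
  rewrite /g -lerBrDl mulrC -ler_pdivlMr// ler_pdivrMr//.
have bg : b - g i <= k%:R^-1.
  have E : (b - a0) / (1 - a0) - i%:R / k%:R <= k%:R^-1.
    rewrite lerBlDr -{1}[k%:R^-1]mul1r -mulrDl ler_pdivlMr//.
    by apply: le_trans i2 _; rewrite -addn1 natrD addrC.
  have -> : b - g i = (1 - a0) * ((b - a0) / (1 - a0) - i%:R / k%:R).
    by rewrite /g; field; rewrite !gt_eqF.
  apply: le_trans (ler_wpM2l (ltW c0) E) _.
  by rewrite ler_piMl ?invr_ge0// lerBlDr lerDl ltW.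
exists (g i); first by rewrite gp gb.
apply: le_trans (Heps (g i) _); last by rewrite g0 g1.
have := Tb i; have := gp i; have := g0 i; have := g1 i.
set a := g i in gb bg *; set C := renyi_cap a W; set T := ln (tilt_sum _ _ _).
move=> a1 aa0 ap HT.
(* The second term is the cost of rounding the order, at most [rho / (k%:R * a0 ^+ 2)]. *)
have -> : - T / a - (1 - b) / b * rho =
   (- T - (1 - a) * rho) / a + (b - a) * rho / (a * b).
  by field; rewrite !gt_eqF.
apply: lerD.
  rewrite (mulrAC _ a^-1) ler_wpM2r ?invr_ge0 ?(ltW ap)//; lra.
have -> : (b - a) * rho / (a * b) = rho * ((b - a) / (a * b)) by ring.
have -> : rho / (k%:R * a0 ^+ 2) = rho * (k%:R^-1 / a0 ^+ 2) by rewrite invfM mulrA.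
rewrite ler_wpM2l// ler_pM ?subr_ge0 ?invr_ge0 ?mulr_ge0 ?(ltW ap) ?(ltW b0)//.
rewrite lef_pV2 ?posrE ?exprn_gt0 ?mulr_gt0// expr2.
by rewrite ler_pM// ltW.
Qed.

End blocks.

(** * Padding and cutting into blocks *)

Section concatenation.
Context {R : realType} {X Y : finType}.

Lemma ssum_cat (m n : nat) (F : seq Y -> R) :
  ssum (m + n) F = ssum m (fun s => ssum n (fun u => F (s ++ u))).
Proof.
by elim: m F => [//|m IH] F; rewrite addSn /=; apply: eq_bigr => y _; rewrite IH.
Qed.

Lemma fprod_cat {E : Type} (K : E -> Y -> R) (f : seq Y -> E) s u :
  fprod K f (s ++ u) = fprod K f s * fprod K (fun v => f (s ++ v)) u.
Proof. by elim: s f => [|y s IH] f /=; rewrite ?mul1r// IH mulrA. Qed.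

(** Padding is free: the steps after the first [n] carry total mass 1 and [F] ignores them. *)
Lemma ssum_take (K : X -> Y -> R) (f : seq Y -> X) n N (F : seq Y -> R) :
  (forall x, \sum_y K x y = 1) -> (n <= N)%N ->
  ssum N (fun s => fprod K f s * F (take n s)) = ssum n (fun s => fprod K f s * F s).
Proof.
move=> K1 nN; rewrite -(subnKC nN) ssum_cat; apply: ssum_ext => s sn.
rewrite (ssum_ext _ _ (fun u => (fprod K f s * F s) * fprod K (fun v => f (s ++ v)) u)).
  by rewrite ssumZ ssum_fprod// mulr1.
by move=> u _; rewrite fprod_cat -sn take_size_cat//; ring.
Qed.

Variable k : nat.

Definition unblock (S : seq (k.-tuple Y)) : seq Y := flatten (map val S).

Lemma ssum_unblock b (F : seq Y -> R) :
  ssum (b * k) F = ssum b (fun S => F (unblock S)).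
Proof.
elim: b F => [//|b IH] F; rewrite mulSn ssum_cat ssum_tuple /=.
by apply: eq_bigr => t _; rewrite IH.
Qed.

(** The past blocks determine the strategy used inside the next block, so a feedback path is again a
    feedback path whose letters are blocks. *)
Lemma fprod_unblock (W : X -> Y -> R) (f : seq Y -> X) (S : seq (k.-tuple Y)) :
  fprod (fun (e : seq Y -> X) (t : k.-tuple Y) => fprod W e t)
    (fun S' u => f (unblock S' ++ u)) S = fprod W f (unblock S).
Proof.
elim: S f => [//|t S IH] f /=.
rewrite /unblock /= fprod_cat; congr (_ * _).
rewrite -/(unblock S) -IH; congr fprod.
by apply/funext => S'; apply/funext => u; rewrite catA.
Qed.

End concatenation.

(** * Codes as strategies on output words *)

Section codes.
Context {R : realType} {X Y : finType}.
Variables (x0 : X) (y0 : Y).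

Definition past_of (n : nat) (s : seq Y) : {ffun 'I_n -> Y} :=
  [ffun i : 'I_n => nth y0 s i].

(** The default [x0] is the input sent during the padded steps, when the past has length [n] or
    more. *)
Definition strategy n (e : fb_input X Y n) (s : seq Y) : X :=
  if insub (size s) is Some t then e t (past_of t s) else x0.

Lemma fprodE (W : X -> Y -> R) f s :
  fprod W f s = \prod_(t < size s) W (f (take t s)) (nth y0 s t).
Proof.
elim: s f => [|y s IH] f /=; first by rewrite big_ord0.
by rewrite big_ord_recl /= IH.
Qed.

Lemma fb_chanE (W : X -> Y -> R) n (e : fb_input X Y n) s : size s = n ->
  fb_chan W e (past_of n s) = fprod W (strategy n e) s.
Proof.
move=> sn; rewrite fprodE /fb_chan sn; apply: eq_bigr => t _.
rewrite ffunE; congr (W _ _); rewrite /strategy.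
have st : size (take t s) = t by rewrite size_take sn ltn_ord.
case: insubP => [t' _ t't|]; last by rewrite st ltn_ord.
have {t't} -> : t' = t by apply: val_inj; rewrite /= t't.
congr (e t _); apply/ffunP => i; rewrite !ffunE /=.
by rewrite nth_take.
Qed.

Lemma sum_ffun_ssum n (F : {ffun 'I_n -> Y} -> R) :
  \sum_y F y = ssum n (fun s => F (past_of n s)).
Proof.
rewrite ssum_tuple (reindex (fun t : n.-tuple Y => past_of n t))//=.
exists (fun y : {ffun 'I_n -> Y} => [tuple y i | i < n]) => [t _|y _].
  by apply: eq_from_tnth => i; rewrite tnth_mktuple ffunE -tnth_nth.
by apply/ffunP => i; rewrite ffunE -tnth_nth tnth_mktuple.
Qed.

Lemma err_probE (W : X -> Y -> R) n M L (c : fb_code X Y n M L) :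
  err_prob W c = M%:R^-1 * \sum_(m < M)
    ssum n (fun s => fprod W (strategy n (enc c m)) s * (m \notin dec c (past_of n s))%:R).
Proof.
rewrite /err_prob; congr (_ * _); apply: eq_bigr => m _.
rewrite big_mkcond sum_ffun_ssum; apply: ssum_ext => s sn.
by rewrite fb_chanE//; case: ifP; rewrite ?mulr1 ?mulr0.
Qed.

Lemma err_prob_block_bound (W : X -> Y -> R) n M L (c : fb_code X Y n M L)
    (k : nat) (a0 rho eps s0 : R) :
  is_channel W -> (0 < M)%N -> (0 < k)%N -> (n <= k * k)%N ->
  0 < a0 -> a0 < 1 -> 0 <= eps -> 0 <= rho -> 0 < s0 ->
  k%:R * renyi_cap a0 W + ln k.+1%:R <= rho ->
  (forall b, a0 <= b < 1 ->
    (1 - b) / b * (k%:R * renyi_cap b W + ln k.+1%:R - rho) + rho / (k%:R * a0 ^+ 2) <= eps) ->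
  expR (- (k%:R * eps + s0)) *
    (1 - 2 * (k%:R * (2 * (k%:R * letter_bound W)) ^+ 2 / s0 ^+ 2)
       - expR (k%:R * rho + s0) * (L%:R / M%:R)) <= err_prob W c.
Proof.
move=> Wch M0 k0 nk a00 a01 eps0 rho0 s00 H0 Heps.
have [q [q0 q1] Hq] := block_kernel W x0 y0 k a0 rho eps Wch k0 a00 a01 eps0 rho0 H0 Heps.
have /choice[v Hv] := Hq; have /choice[z1 Hz1] := Hv; have /choice[z2 H] := Hz1.
pose A : finType := k.-tuple Y.
pose w (e : seq Y -> X) (t : A) := fprod W e t.
(* The decoder of the padded code discards the outputs after the first [n]. *)
pose dec' (S : seq A) := dec c (past_of n (take n (unblock k S))).
pose g (m : 'I_M) (S : seq A) (u : seq Y) := strategy n (enc c m) (unblock k S ++ u).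
have -> : err_prob W c = M%:R^-1 * \sum_m ssum k (fun S => fprod w (g m) S * (m \notin dec' S)%:R).
  rewrite err_probE; congr (_ * _); apply: eq_bigr => m _.
  rewrite -(ssum_take _ _ _ (k * k) _ Wch.2 nk) ssum_unblock.
  by apply: ssum_ext => S _; rewrite -fprod_unblock.
apply: (feedback_code_error w v z1 z2 q) => //.
- by move=> e t; apply: fprod_ge0; exact: Wch.1.
- by move=> e t; have [[]] := H e.
- by move=> e; have [[]] := H e.
- by move=> e; have [[]] := H e.
- by move=> e; have [[]] := H e.
- by move=> e; have [] := H e.
- by move=> e; have [] := H e.
- by move=> t; exact: ltW.
- by move=> e t; have [] := H e.
- by move=> e t; have [] := H e.
- by move=> S; exact: dec_card.
Qed.

End codes.

(** * Block length and growth estimates *)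

Section asymptotics.
Context {R : realType}.

(** Take the least [k] with [n <= k * k]; then [(k - 1)^2 < n], so padding adds at most [2 * k]
    steps. *)
Lemma ceil_sqrt (n : nat) : (0 < n)%N ->
  exists k, [/\ (0 < k)%N, (n <= k * k)%N, (k * k <= n + 2 * k)%N & (k * k <= 4 * n)%N].
Proof.
move=> n0; have ex : exists k, (n <= k * k)%N by exists n; rewrite leq_pmulr.
case: (ex_minnP ex) => k nk kmin; exists k.
case: k => [|k] in nk kmin *; first by move: n0 nk; case: n {ex kmin}.
have kn : (k * k < n)%N by rewrite ltnNge; apply/negP => /kmin; rewrite ltnn.
split=> //.
  by rewrite mulSn mulnS; lia.
case: k => [|k] in nk kmin kn *; first by lia.
have : (k * k <= k.+1 * k.+1)%N by nia.
nia.
Qed.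

(** Makes the mixture cost of [k] blocks, [k * ln k.+1], of the same order [k^(3/2)] as the
    fluctuations. *)
Lemma ln_succ_le_sqrt (k : nat) : (0 < k)%N -> ln k.+1%:R <= 4 * Num.sqrt k%:R :> R.
Proof.
move=> k0; have k1 : 0 < k.+1%:R :> R by rewrite ltr0n.
have s0 : 0 < Num.sqrt k.+1%:R :> R by rewrite sqrtr_gt0.
have -> : ln k.+1%:R = 2 * ln (Num.sqrt k.+1%:R) :> R.
  by rewrite -{1}(sqr_sqrtr (ltW k1)) lnXn// mulr_natl.
have H1 : ln (Num.sqrt k.+1%:R) <= Num.sqrt k.+1%:R :> R by apply/ltW/ln_sublinear.
have H2 : Num.sqrt k.+1%:R <= 2 * Num.sqrt k%:R :> R.
  have -> : 2 * Num.sqrt k%:R = Num.sqrt (4 * k%:R) :> R.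
    rewrite sqrtrM ?ler0n//; congr (_ * _).
    by rewrite (_ : 4 = 2 ^+ 2) ?sqrtr_sqr ?ger0_norm//; ring.
  rewrite ler_sqrt ?mulr_ge0// -[4]/(4%:R) -natrM ler_nat; lia.
lra.
Qed.

End asymptotics.

(** * The sphere packing bound *)

Section sphere_packing.
Context {R : realType} {X Y : finType}.
Variable W : X -> Y -> R.
Hypothesis Wch : is_channel W.

Lemma letter_bound_ge1 (y0 : Y) : 1 <= letter_bound W.
Proof.
have : 0 <= ln #|Y|%:R :> R.
  by apply: ln_ge0; rewrite ler1n; apply/card_gt0P; exists y0.
have : 0 <= \sum_x \sum_y `|ln (W x y)|.
  by apply: sumr_ge0 => x _; exact: sumr_ge0.
by rewrite /letter_bound; lra.
Qed.

Lemma err_prob_ge0 n M L (c : fb_code X Y n M L) : 0 <= err_prob W c.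
Proof.
rewrite mulr_ge0 ?invr_ge0//; apply: sumr_ge0 => m _; apply: sumr_ge0 => y _.
by apply: prodr_ge0 => t _; exact: Wch.1.
Qed.

Lemma sp_exp_lb (r b : R) : 0 < b ->
  (((1 - b) / b * (renyi_cap b W - r))%:E <= sp_exp r W)%E.
Proof. by move=> b0; apply: ereal_sup_ubound; exists b. Qed.

(** Collects the losses in units of [k^(3/2)]: padding in the exponent, mixture, fluctuations
    ([4 * s0] in all), order grid, and padding in the rate condition. *)
Definition slack_const (a0 C1 : R) : R :=
  2 * ln #|Y|%:R + 4 + 32 * letter_bound W + C1 / a0 + 2 * renyi_cap a0 W.

Lemma block_rate_estimates (x0 : X) (y0 : Y) (n k : nat) (a0 C1 r E d rho eps s0 : R) :
  (0 < k)%N -> (n <= k * k)%N -> (k * k <= n + 2 * k)%N ->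
  0 < a0 -> a0 < 1 -> 0 <= E -> 0 <= r -> r <= C1 ->
  renyi_cap a0 W + d <= r ->
  (forall b, 0 < b -> (1 - b) / b * (renyi_cap b W - r) <= E) ->
  s0 = 8 * letter_bound W * k%:R * Num.sqrt k%:R ->
  k%:R * Num.sqrt k%:R * slack_const a0 C1 <= n%:R * d ->
  k%:R * rho = n%:R * r - 2 * s0 ->
  k%:R * eps = n%:R * (E + a0^-1 * d) - 2 * s0 ->
  [/\ 0 <= rho, 0 <= eps, k%:R * renyi_cap a0 W + ln k.+1%:R <= rho &
    forall b, a0 <= b < 1 ->
     (1 - b) / b * (k%:R * renyi_cap b W + ln k.+1%:R - rho) + rho / (k%:R * a0 ^+ 2) <= eps].
Proof.
move=> k0 nk kn a00 a01 E0 r0 rC1 Cd HE Hs0 HK Hrho Heps.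
have kp : 0 < k%:R :> R by rewrite ltr0n.
have n0 : 0 <= n%:R :> R by [].
have nk' : n%:R <= k%:R * k%:R :> R by rewrite -natrM ler_nat.
have kn' : k%:R * k%:R <= n%:R + 2 * k%:R :> R by rewrite -!natrM -natrD ler_nat.
have c1 := letter_bound_ge1 y0; set c := letter_bound W in c1 Hs0.
have ly : 0 <= ln #|Y|%:R :> R.
  by apply: ln_ge0; rewrite ler1n; apply/card_gt0P; exists y0.
have C00 := renyi_cap_ge0 W a0 Wch a00 a01.
have la := @ln_succ_le_sqrt R k k0.
set la1 := ln k.+1%:R in la *.
have la0 : 0 <= la1 by apply: ln_ge0; rewrite ler1n.
set e := Num.sqrt k%:R in la Hs0 HK.
have e1 : 1 <= e by rewrite -[leLHS]sqrtr1 ler_sqrt// ler1n.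
pose T := k%:R * e.
have kT : k%:R <= T by rewrite /T ler_peMr// ltW.
have laT : k%:R * la1 <= 4 * T.
  by rewrite /T mulrCA ler_wpM2l// ltW.
have T0 : 0 <= T by rewrite mulr_ge0// ltW// (lt_le_trans _ e1).
have sT : s0 = 8 * (T * c) by rewrite Hs0 /T; ring.
have Tc : 0 <= T * c by rewrite mulr_ge0// (le_trans _ c1).
have C10 : 0 <= C1 by exact: le_trans rC1.
set C0 := renyi_cap a0 W in C00 Cd HK *.
have Ca0 : 0 <= C1 / a0 by rewrite divr_ge0// ltW.
have HK' : T * (2 * ln #|Y|%:R) + 4 * T + 32 * (T * c) + T * (C1 / a0) + 2 * (T * C0) <= n%:R * d.
  by apply: le_trans HK; rewrite /slack_const -/c -/C0 -/T; lra.
have P1 : 0 <= T * (2 * ln #|Y|%:R) by rewrite mulr_ge0// mulr_ge0.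
have P2 : 0 <= T * (C1 / a0) by rewrite mulr_ge0.
have P3 : 0 <= T * C0 by rewrite mulr_ge0.
have kC0 : k%:R * C0 <= T * C0 by rewrite ler_wpM2r.
have Hrho0 : k%:R * C0 + la1 <= rho.
  rewrite -(ler_pM2l kp) Hrho.
  have := ler_wpM2r C00 kn'; have := ler_wpM2l n0 Cd; lra.
have rho0 : 0 <= rho.
  by apply: le_trans Hrho0; rewrite addr_ge0// mulr_ge0// ltW.
have ai : 1 <= a0^-1 by rewrite invf_ge1// ltW.
have eps0 : 0 <= eps.
  rewrite -(pmulr_rge0 _ kp) Heps.
  have nd : 0 <= n%:R * d by lra.
  have := ler_wpM2r nd ai; have := mulr_ge0 n0 E0; lra.
split=> // b /andP[ab b1].
have b0 : 0 < b by exact: lt_le_trans ab.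
rewrite -(ler_pM2l kp) Heps.
pose B := (1 - b) / b.
have B0 : 0 <= B by rewrite divr_ge0 ?subr_ge0// ltW.
have ib : b^-1 <= a0^-1 by rewrite lef_pV2.
have Ba : B <= a0^-1.
  apply: le_trans ib; rewrite /B -[leRHS]mul1r ler_wpM2r ?invr_ge0 ?(ltW b0)//; lra.
(* The factor [1 - b] in [B] cancels the blow-up of the capacity bound as [b] tends to 1. *)
have BC : B * renyi_cap b W <= ln #|Y|%:R / a0.
  have := renyi_cap_ub W b Wch b0 b1 x0; move=> /(ler_wpM2l B0) /le_trans; apply.
  have -> : B * (ln #|Y|%:R / (1 - b)) = ln #|Y|%:R / b.
    by rewrite /B; field; rewrite !gt_eqF// subr_gt0.
  by rewrite ler_wpM2l.
have Cb0 := renyi_cap_ge0 W b Wch b0 b1.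
have BC0 : 0 <= B * renyi_cap b W by rewrite mulr_ge0.
have HEb := ler_wpM2l n0 (HE b b0).
have rk : rho <= k%:R * C1.
  rewrite -(ler_pM2l kp) Hrho.
  have := ler_wpM2r C10 nk'; have := ler_wpM2l n0 rC1.
  have : 0 <= s0 by rewrite sT mulr_ge0.
  lra.
(* The losses in turn: [Q1] the order grid, [Q2] padding, [Q3] the mixture and the lowered rate,
   [Q4] the lowered exponent. Since [B <= a0^-1], their sum fits under [a0^-1 * (n%:R * d)]. *)
have Q1 : k%:R * (rho / (k%:R * a0 ^+ 2)) <= a0^-1 * (T * (C1 / a0)).
  have -> : k%:R * (rho / (k%:R * a0 ^+ 2)) = a0^-1 * (rho / a0).
    by field; rewrite !gt_eqF.
  rewrite ler_wpM2l ?invr_ge0 ?(ltW a00)// mulrA ler_wpM2r ?invr_ge0 ?(ltW a00)//.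
  by apply: le_trans rk _; rewrite ler_wpM2r.
have Q2 : (k%:R * k%:R - n%:R) * (B * renyi_cap b W) <= a0^-1 * (T * (2 * ln #|Y|%:R)).
  apply: (@le_trans _ _ (2 * T * (ln #|Y|%:R / a0))).
    apply: ler_pM => //; first by rewrite subr_ge0.
    lra.
  by rewrite le_eqVlt; apply/orP; left; apply/eqP; ring.
have Q3 : B * (k%:R * la1 + 2 * s0) <= a0^-1 * (4 * T + 16 * (T * c)).
  apply: ler_pM => //; first by have := mulr_ge0 (ltW kp) la0; rewrite sT; lra.
  by rewrite sT; lra.
have Q4 : 16 * (T * c) <= a0^-1 * (16 * (T * c)).
  by rewrite ler_peMl// mulr_ge0.
have Q5 : a0^-1 * (T * (2 * ln #|Y|%:R)) + a0^-1 * (4 * T + 16 * (T * c))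
    + a0^-1 * (T * (C1 / a0)) + a0^-1 * (16 * (T * c)) <= a0^-1 * (n%:R * d).
  rewrite -!mulrDr ler_wpM2l ?(le_trans _ ai)//; apply: le_trans HK'.
  by clear -P3; lra.
have Q7 : k%:R * (B * (k%:R * renyi_cap b W + la1 - rho)) =
   n%:R * (B * (renyi_cap b W - r)) + (k%:R * k%:R - n%:R) * (B * renyi_cap b W)
   + B * (k%:R * la1 + 2 * s0).
  have -> : k%:R * (B * (k%:R * renyi_cap b W + la1 - rho)) =
     B * (k%:R * k%:R * renyi_cap b W + k%:R * la1 - k%:R * rho) by ring.
  by rewrite Hrho; ring.
rewrite -/B in HEb.
have -> : n%:R * (E + a0^-1 * d) - 2 * s0 = n%:R * E + a0^-1 * (n%:R * d) - 16 * (T * c).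
  by rewrite sT; ring.
rewrite mulrDr -/B Q7; clear -HEb Q1 Q2 Q3 Q4 Q5.
move: HEb Q1 Q2 Q3 Q4 Q5; move: (a0^-1 * _) (a0^-1 * _) (a0^-1 * _) (a0^-1 * _) (a0^-1 * _) => *.
lra.
Qed.

(** From [k <= 2 * n^(1/2)]: losses of order [k^(3/2)] are absorbed by [n^(3/4) ln n] once [ln n]
    exceeds a constant. *)
Lemma natr_quarter_root (n k : nat) : (k * k <= 4 * n)%N ->
  4^-1 * (k%:R * Num.sqrt k%:R) * n%:R `^ 4^-1 <= n%:R :> R.
Proof.
move=> kn; set r := n%:R `^ 4^-1.
have r0 : 0 <= r by exact: powR_ge0.
have rn : r ^+ 4 = n%:R.
  by rewrite -powR_mulrn// -powRrM mulVf ?powRr1.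
have kr : k%:R <= 2 * r ^+ 2.
  rewrite -(@ler_pXn2r _ 2) ?nnegrE ?mulr_ge0 ?sqr_ge0//.
  rewrite exprMn -exprM rn expr2 -natrM -natrX -natrM ler_nat; lia.
have sr : Num.sqrt k%:R <= 2 * r.
  rewrite -[leRHS]ger0_norm ?mulr_ge0// -sqrtr_sqr ler_sqrt ?sqr_ge0//.
  by rewrite exprMn; have := sqr_ge0 r; lra.
apply: (@le_trans _ _ (4^-1 * ((2 * r ^+ 2) * (2 * r)) * r)).
  by rewrite ler_wpM2r// ler_wpM2l// ler_pM ?sqrtr_ge0.
by rewrite -rn le_eqVlt; apply/orP; left; apply/eqP; field.
Qed.

Lemma sphere_packing_nonasymptotic n M L (c : fb_code X Y n M L) (a0 C1 E : R) :
  let r := n%:R^-1 * ln (M%:R / L%:R) in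
  let d := ln n%:R / n%:R `^ 4^-1 in
  (1 < n)%N -> 0 < a0 -> a0 < 1 -> r <= C1 -> renyi_cap a0 W + d <= r ->
  4 * slack_const a0 C1 <= ln n%:R ->
  (forall b, 0 < b -> (1 - b) / b * (renyi_cap b W - r) <= E) ->
  expR (- (n%:R * (E + a0^-1 * d))) <= err_prob W c.
Proof.
move=> r d n1 a00 a01 rC1 Cd Kn HE.
have n0 : (0 < n)%N by exact: ltn_trans n1.
have np : 0 < n%:R :> R by rewrite ltr0n.
have d0 : 0 < d by rewrite divr_gt0 ?powR_gt0// ln_gt0// ltr1n.
have C00 := renyi_cap_ge0 W a0 Wch a00 a01.
have r0 : 0 < r by lra.
have nr : n%:R * r = ln (M%:R / L%:R) by rewrite /r mulrA divff ?gt_eqF// mul1r.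
(* Otherwise the logarithm, hence the rate, would be 0. Thus a message exists, and its first input
   shows that [X] is inhabited. *)
have LM0 : 0 < M%:R / L%:R :> R.
  rewrite ltNge; apply/negP => H.
  by have := mulr_gt0 np r0; rewrite nr ln0// ltxx.
have L0 : 0 < L%:R :> R by rewrite ltr0n; exact: L_gt0 c.
have M0 : (0 < M)%N.
  by move: LM0; rewrite pmulr_lgt0 ?invr_gt0// ltr0n.
have x0 : X.
  have t0 : {ffun 'I_(Ordinal n0) -> Y} by apply: finfun => -[i].
  exact (enc c (Ordinal M0) t0).
have [y0 _] : exists y : Y, True.
  apply: contrapT => /forallNP H; have := Wch.2 x0; rewrite big_pred0 => [/eqP|y].
    by rewrite eq_sym oner_eq0.
  by case: (H y).
have [k [k0 nk kn k4n]] := ceil_sqrt n n0.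
have kp : 0 < k%:R :> R by rewrite ltr0n.
set e := Num.sqrt (k%:R : R).
have e1 : 1 <= e by rewrite -[leLHS]sqrtr1 ler_sqrt// ler1n.
have e2 : e ^+ 2 = k%:R by rewrite sqr_sqrtr// ltW.
have c1 := letter_bound_ge1 y0.
(* The factor 8 makes the two Chebyshev terms add up to exactly [1 / 8]. *)
pose s0 := 8 * letter_bound W * k%:R * e.
have HK : k%:R * e * slack_const a0 C1 <= n%:R * d.
  rewrite /d mulrA ler_pdivlMr ?powR_gt0//.
  have Q := natr_quarter_root _ _ k4n.
  have S0 : 0 <= slack_const a0 C1.
    rewrite /slack_const; have : 0 <= ln #|Y|%:R :> R.
      by apply: ln_ge0; rewrite ler1n; apply/card_gt0P; exists y0.
    have : 0 <= C1 / a0 by rewrite divr_ge0; lra.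
    lra.
  apply: (@le_trans _ _ (n%:R * (4 * slack_const a0 C1))); last by rewrite ler_wpM2l// ltW.
  have := ler_wpM2r S0 Q; rewrite -/e; nra.
(* The term of order 1 in the supremum vanishes. *)
have E0 : 0 <= E.
  by have := HE 1 ltr01; rewrite subrr !mul0r.
(* Of the [2 * s0] subtracted, one [s0] pays for the fluctuation and the other leaves a factor
   [expR (- s0)] of margin. *)
pose rho := (n%:R * r - 2 * s0) / k%:R.
pose eps := (n%:R * (E + a0^-1 * d) - 2 * s0) / k%:R.
have Hrho : k%:R * rho = n%:R * r - 2 * s0 by rewrite mulrC divfK// gt_eqF.
have Heps : k%:R * eps = n%:R * (E + a0^-1 * d) - 2 * s0 by rewrite mulrC divfK// gt_eqF.
have [rho0 eps0 H0 H1] := block_rate_estimates x0 y0 n k a0 C1 r E d rho eps s0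
  k0 nk kn a00 a01 E0 (ltW r0) rC1 Cd HE erefl HK Hrho Heps.
have k1 : 1 <= k%:R :> R by rewrite ler1n.
have s8 : 8 <= s0.
  rewrite /s0 -[leLHS]mulr1 -!mulrA ler_wpM2l// -[leLHS]mulr1 ler_pM//.
  by rewrite -[leLHS]mulr1 ler_pM.
have s00 : 0 < s0 by lra.
apply: le_trans (err_prob_block_bound x0 y0 W n M L c k a0 rho eps s0 Wch M0 k0 nk
  a00 a01 eps0 rho0 s00 H0 H1).
have -> : 2 * (k%:R * (2 * (k%:R * letter_bound W)) ^+ 2 / s0 ^+ 2) = 8^-1.
  rewrite /s0 -e2; field; rewrite !gt_eqF//; lra.
have -> : expR (k%:R * rho + s0) * (L%:R / M%:R) = expR (- s0).
  have -> : L%:R / M%:R = expR (- (n%:R * r)).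
    by rewrite nr expRN lnK ?posrE// invf_div.
  by rewrite -expRD Hrho; congr expR; ring.
have -> : - (n%:R * (E + a0^-1 * d)) = - (k%:R * eps + s0) - s0 by rewrite Heps; ring.
rewrite expRD ler_wpM2l ?expR_ge0//.
(* What remains is [expR (- s0) <= 1 - 1/8 - expR (- s0)], and [8 <= s0] gives enough. *)
have : expR (- s0) <= 9^-1.
  rewrite expRN lef_pV2 ?posrE ?expR_gt0//.
  by apply: le_trans (expR_ge1Dx _); lra.
lra.
Qed.

End sphere_packing.

Theorem theorem4 (R : realType) (X Y : finType) (W : X -> Y -> R)
  (a0 a1 : R) (M L : nat -> nat) (c : forall n : nat, fb_code X Y n (M n) (L n))
  (n0 : nat) :
  is_channel W ->
  0 < a0 -> a0 < a1 -> a1 < 1 ->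
  (forall n : nat, (n0 <= n)%N ->
     renyi_cap a1 W >= n%:R^-1 * ln ((M n)%:R / (L n)%:R) /\
     n%:R^-1 * ln ((M n)%:R / (L n)%:R)
       >= renyi_cap a0 W + ln n%:R / (n%:R `^ 4^-1)) ->
  exists n1 : nat, (n0 <= n1)%N /\
    forall n : nat, (n1 <= n)%N ->
      ((err_prob W (c n))%:E >=
       expeR (- (n%:R)%:E *
              (sp_exp (n%:R^-1 * ln ((M n)%:R / (L n)%:R)) W
               + (a0^-1 * (ln n%:R / (n%:R `^ 4^-1)))%:E)))%E.
Proof.
move=> Wch a00 a01 a11 H.
pose K := expR (4 * slack_const W a0 (renyi_cap a1 W)).
exists (maxn n0 (maxn 2 (Num.truncn K).+1)); split; first exact: leq_maxl.
move=> n; rewrite !geq_max => /and3P[nn0 n2 nK].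
have np : 0 < n%:R :> R by rewrite ltr0n (leq_trans _ n2).
have [H1 H2] := H n nn0.
have Kn : 4 * slack_const W a0 (renyi_cap a1 W) <= ln n%:R.
  rewrite -[leLHS]expRK ler_ln ?posrE ?expR_gt0//.
  apply: ltW; apply: lt_le_trans (truncnS_gt _) _; by rewrite ler_nat.
set r := n%:R^-1 * _ in H1 H2 *.
(* A finite exponent bounds every order's term; an infinite one makes the claimed lower bound 0; the
   order 1 term rules out minus infinity. *)
have := sp_exp_lb W r; case: (sp_exp r W) => [E|_|/(_ 1 ltr01)//].
  move=> HE; rewrite -EFinD -EFinN -EFinM /= lee_fin mulNr.
  apply: (sphere_packing_nonasymptotic W Wch n _ _ (c n) a0 (renyi_cap a1 W)) => //.
    exact: lt_trans a11.
rewrite addye// -EFinN mulry ltr0_sg ?oppr_lt0// mulN1e /= lee_fin.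
exact: err_prob_ge0.
Qed.
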